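(* If $G$ is a planar graph with girth at least $7$, then $\mathrm{col}_g(G) \leq 5$.
   Context: Graphs are finite and simple. The girth of a graph is the length of its shortest cycle (infinite if the graph has no cycle). The marking game on a graph $G$ is played by two players, Alice and Bob, with Alice playing first. They alternately mark an unmarked vertex of $G$ until all vertices are marked. For each vertex $v$, let $b(v)$ be the number of neighbors of $v$ that are marked before $v$ is marked. The game coloring number of $G$, denoted $\mathrm{col}_g(G)$, is the least $s$ such that Alice has a strategy guaranteeing that, whatever Bob plays, $b(v)+1 \leq s$ for every vertex $v$ of $G$. *)

(* Defs.v *)
From HB Require Import structures.
From mathcomp Require Import all_boot all_order all_algebra.
From mathcomp Require Import all_classical all_reals all_analysis.
Set Implicit Arguments.
Unset Strict Implicit.
Unset Printing Implicit Defensive.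
Import Order.TTheory GRing.Theory Num.Theory.
Import numFieldNormedType.Exports.
Local Open Scope classical_set_scope.
Local Open Scope ring_scope.

(* A finite simple graph is a symmetric irreflexive relation [e] on a finite
   type [V] of vertices. *)

Section Girth.
Variables (R : realType) (V : finType) (e : rel V).

Definition graph_cycle (c : seq V) : Prop :=
  [/\ (3 <= size c)%N, uniq c & cycle e c].

(* The infimum of the empty set is [+oo], so forests have infinite girth. *)
Definition girth : \bar R :=
  ereal_inf [set ((size c)%:R)%:E | c in [set c | graph_cycle c]].

End Girth.

Section Planarity.
Variable R : realType.

Definition arc_between (p q : R * R) (A : set (R * R)) : Prop :=
  exists g : R -> R * R,
    [/\ {within `[0, 1], continuous g},
        {in `[0, 1] &, injective g},
        g 0 = p, g 1 = q & A = g @` `[0, 1]].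

(* [arc u v] is only relevant when [e u v]; it is the set of points of the
   edge uv, endpoints included. *)
Definition plane_drawing (V : finType) (e : rel V)
    (pos : V -> R * R) (arc : V -> V -> set (R * R)) : Prop :=
  [/\ injective pos,
      forall u v, e u v ->
        arc_between (pos u) (pos v) (arc u v) /\ arc v u = arc u v,
      forall u v w, e u v -> arc u v (pos w) -> w = u \/ w = v
    & forall u v x y, e u v -> e x y -> (x, y) != (u, v) -> (x, y) != (v, u) ->
        forall z, arc u v z -> arc x y z ->
          exists2 w, z = pos w & (w = u \/ w = v) /\ (w = x \/ w = y)].

Definition planar (V : finType) (e : rel V) : Prop :=
  exists pos arc, @plane_drawing V e pos arc.

End Planarity.

Section MarkingGame.
Variables (V : finType) (e : rel V).

(* A position is the sequence of the vertices marked so far, in the order in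
   which they were marked; Alice moves when its size is even.  A strategy maps
   positions to moves; the codomain is [option V] because no move exists when
   all the vertices are marked (in particular when [V] is empty). *)
Definition strategy := seq V -> option V.

Definition legal_strategy (sigma : strategy) : Prop :=
  forall h : seq V, uniq h -> (size h < #|V|)%N -> ~~ odd (size h) ->
    exists2 v, sigma h = Some v & v \notin h.

Definition complete_play (p : seq V) : Prop := uniq p /\ size p = #|V|.

Definition follows (sigma : strategy) (p : seq V) : Prop :=
  forall (h : seq V) (v : V),
    prefix (rcons h v) p -> ~~ odd (size h) -> sigma h = Some v.

Definition marked_before (p : seq V) (v : V) : nat :=
  #|[pred u | e u v && (index u p < index v p)%N]|.

Definition alice_guarantees (s : nat) : Prop :=
  exists2 sigma : strategy, legal_strategy sigma &
    forall p, complete_play p -> follows sigma p ->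
      forall v, (marked_before p v + 1 <= s)%N.

Lemma alice_guarantees_some : exists s, `[< alice_guarantees s >].
Proof.
exists (#|V| + 1)%N; apply/asboolP.
exists (fun h => [pick v | v \notin h]) => [h uh lt_h _|p _ _ v].
  case: pickP => [v vh|all_in]; first by exists v.
  have : (size (enum V) <= size h)%N.
    apply: uniq_leq_size (enum_uniq _) _ => x _.
    by move/negbFE: (all_in x).
  by rewrite -cardE leqNgt lt_h.
by rewrite leq_add2r max_card.
Qed.

Definition game_coloring_number : nat := ex_minn alice_guarantees_some.

End MarkingGame.

(* Main.v *)
(** Let every vertex [u] choose a vertex [f u] that it serves, in such a way that
    at most three elements [u] of each closed neighbourhood N[v] have [f u <> v].
    Alice then plays an activation strategy: when Bob marks [x], she follows
    [x, f x, f (f x), ...], activating what she meets, and marks the first vertex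
    that was already active or that serves itself.  A vertex with [f v <> v] has
    at most two unserving neighbours and is marked at its second active server; a
    vertex with [f v = v] has at most three and is marked at its first; either
    way at most four neighbours are marked before it.

    By Hall's theorem such an [f] exists as soon as the sum of [deg v - 2] over a
    set [X] of vertices is at most the size of N[X], and this follows from the
    bound 5 |E'| <= 7 |V'| for the subgraph made of the edges between [X] and
    the vertices that are in [X] or have two neighbours in [X].

    The bound 5 |E| <= 7 |V| comes from a weak form of Euler's formula that avoids
    the Jordan curve theorem.  The arcs are replaced by polygonal lines, straight
    near the vertices.  For an edge set [C] of even degrees and a point [z] off
    the drawing, the parity w(C, z) of the number of crossings of [C] with a
    horizontal ray from [z] is locally constant, and it jumps exactly when [z]
    crosses an edge of [C].  Call w(., z) the face of [z].  Every edge has two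
    sides, turning around a vertex shows that the edges with exactly one side on
    a given face form an even set, and these sets span the even sets.  An even
    set being empty or of size at least the girth g, the cycle space has dimension
    at most 2 |E| / g, and at least |E| - |V|. *)

Require Import Defs.
From mathcomp Require Import all_boot all_order all_algebra.
From mathcomp Require Import boolp.
From mathcomp Require Import zify ring lra.
Set Implicit Arguments.
Unset Strict Implicit.
Unset Printing Implicit Defensive.

(** * The activation strategy *)

Section Activation.
Variables (V : finType) (e : rel V) (f : V -> V).
Hypothesis e_irr : irreflexive e.
Hypothesis unserved : forall v,
  #|[pred u | (e u v || (u == v)) && (f u != v)]| <= 3.
Implicit Types (A M : {set V}) (u v x y m : V).

Definition served_by A v := #|[set u in A | f u == v]|.

(* The invariant after each of Alice's moves; [A] is the set of active vertices
   and [M] the set of marked ones.  A vertex with [f v = v] is marked as soon as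
   it is active. *)
Definition settled A M :=
  [/\ M \subset A, (forall u, u \in A -> f u \in A)
    & forall v, v \notin M -> served_by A v <= (f v != v)].

Definition marked_nbrs M v := #|[set u in M | e u v]|.

(** A marked neighbour of [v] is either an active server of [v] or a neighbour that does not serve
    it. If [f v != v], then [v] itself uses up one of the three places in [unserved], which
    compensates for the extra server allowed. *)
Lemma marked_nbrs_le A M v k :
  M \subset A -> v \notin M -> served_by A v <= (f v != v) + k ->
  marked_nbrs M v <= 3 + k.
Proof.
move=> MA vM served.
have split_nbrs : marked_nbrs M v <=
    #|[set u in A | f u == v & u != v]| + #|[set u | e u v & f u != v]|.
  rewrite -cardsUI.
  apply: (leq_trans _ (leq_addr _ _)); apply: subset_leq_card.
  apply/subsetP => u; rewrite !inE => /andP[uM euv].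
  have uA := subsetP MA _ uM.
  rewrite uA euv /=; case: eqP => //= _; rewrite orbF.
  by apply/eqP => uv; rewrite -uv uM in vM.
have := unserved v.
case: (eqVneq (f v) v) served => [fv|fv] /= served unserved_v.
- have : #|[set u in A | f u == v & u != v]| <= k.
    apply: leq_trans served; apply: subset_leq_card.
    by apply/subsetP => u; rewrite !inE => /and3P[-> ->].
  have : #|[set u | e u v & f u != v]| <= 3.
    apply: leq_trans unserved_v; apply: subset_leq_card.
    by apply/subsetP => u; rewrite !inE => /andP[-> ->].
  by lia.
- have : #|[set u in A | f u == v & u != v]| <= 1 + k.
    apply: leq_trans served; apply: subset_leq_card.
    by apply/subsetP => u; rewrite !inE => /and3P[-> ->].
  have : #|[set u | e u v & f u != v]| < 3.
    apply: leq_trans unserved_v; rewrite -(cardsE [pred u | _]).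
    apply: proper_card; apply/properP; split.
      by apply/subsetP => u; rewrite !inE => /andP[-> ->].
    by exists v; rewrite !inE ?eqxx ?orbT ?fv // e_irr.
  by lia.
Qed.

Lemma settled_mark A M m :
  settled A M -> m \in A -> settled A (m |: M).
Proof.
move=> [MA clA served] mA; split=> //.
  by apply/subsetP => u /setU1P[->//|]; apply: (subsetP MA).
by move=> v; rewrite !inE negb_or => /andP[_]; apply: served.
Qed.

Definition marking_move M := exists m A,
  [/\ m \notin M, marked_nbrs M m <= 4 & settled A (m |: M)].

(* Here [f y] may still have to be activated.  The second case of the conclusion
   leaves Alice with a free move. *)
Lemma propagate M A y :
  M \subset A -> y \in A -> (forall u, u \in A -> u != y -> f u \in A) ->
  (forall v, v \notin M -> served_by (A :\ y) v <= (f v != v)) ->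
  marking_move M \/ exists2 A' : {set V}, A \subset A' & settled A' M.
Proof.
have [k] := ubnP #|~: A|; elim: k => // k IH in A y *.
rewrite ltnS => leAk MA yA clA served.
(* Activating [y] changes only the number of active servers of [f y]. *)
have served_y v : f y != v -> served_by A v <= served_by (A :\ y) v.
  move=> fyv; apply: subset_leq_card; apply/subsetP => u; rewrite !inE.
  move=> /andP[uA /eqP fu]; rewrite uA fu eqxx !andbT.
  by apply: contraNneq fyv => <-; rewrite fu.
have [pM|pM] := boolP (f y \in M).
  right; exists A => //; split=> // [u uA|v vM].
    by case: (eqVneq u y) => [->|]; [apply: (subsetP MA)|apply: clA].
  have fyv : f y != v by apply: contraNneq vM => <-.
  exact: leq_trans (served_y _ fyv) (served _ vM).
pose p := f y; have served_p : served_by A p <= (f p != p) + 1.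
  apply: leq_trans (leq_add (served _ pM) (leqnn 1)).
  rewrite /served_by (cardsD1 y) addnC; apply: leq_add; last by case: (_ \in _).
  by apply: subset_leq_card; apply/subsetP => u; rewrite !inE andbA.
(* The walk stops at [p] and marks it: it is already active or serves itself. Once marked, its
   servers are no longer counted. *)
have [p_ends|] := boolP ((p \in A) || (f p == p)).
  left; exists p, (p |: A); split=> //.
    by rewrite (leq_trans (marked_nbrs_le MA pM served_p)).
  split.
  - by apply: setUS.
  - move=> u /setU1P[->|uA].
      rewrite !inE; case: (eqVneq p y) => [py|py].
        by rewrite {1}py eqxx.
      by case/orP: p_ends => [pA|->//]; rewrite clA ?orbT.
    by case: (eqVneq u y) => [->|uy]; [apply: setU11|rewrite setU1r ?clA].
  - move=> v; rewrite !inE negb_or => /andP[vp vM].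
    apply: leq_trans (served _ vM); apply: leq_trans (served_y _ _); last first.
      by rewrite eq_sym.
    apply: subset_leq_card; apply/subsetP => u; rewrite !inE.
    case: (eqVneq u p) => [->|] //= fpv; rewrite fpv andbT.
    by case/orP: p_ends fpv => // /eqP -> /eqP pv; rewrite pv eqxx in vp.
rewrite negb_or => /andP[pA fp].
have [||||//||[A' sA' settA']] := IH (p |: A) p.
- rewrite setCU; apply: leq_trans leAk; apply: proper_card; apply/properP.
  by split; [apply: subsetIr|exists p; rewrite !inE ?eqxx].
- by apply: (subset_trans MA); apply: subsetUr.
- by rewrite !inE eqxx.
- move=> u /setU1P[->|uA _]; first by rewrite eqxx.
  by case: (eqVneq u y) => [->|uy]; [apply: setU11|rewrite setU1r ?clA].
- have -> : (p |: A) :\ p = A by rewrite setU1K.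
  move=> v vM; have [->|vp] := eqVneq v p; last first.
    by rewrite (leq_trans (served_y _ _) (served _ vM)) // eq_sym.
  (* As [p] is not in [A] and [f] maps the active vertices other than [y] into [A], its only active
     server is [y]. *)
  rewrite fp; apply: leq_trans (_ : #|[set y]| <= _); last by rewrite cards1.
  apply: subset_leq_card; apply/subsetP => u; rewrite !inE => /andP[uA /eqP fu].
  by apply: contraNT pA => uy; rewrite -fu clA.
- by left.
- by right; exists A' => //; apply: subset_trans sA'; apply: subsetUr.
Qed.

(** Pick an unmarked [y]. If it is active, marking it is safe; otherwise activate it and propagate:
    the walk either yields a move or ends with [y] active, and [y] is then marked. *)
Lemma free_move A M :
  settled A M -> M != [set: V] -> marking_move M.
Proof.
have mark_active B m : settled B M -> m \in B -> m \notin M -> marking_move M.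
  move=> settB mB mM; exists m, B; split=> //; last exact: settled_mark.
  have [MB _ served] := settB.
  by rewrite (leq_trans (marked_nbrs_le (k := 0) MB mM _)) ?addn0 ?served.
move=> settA; rewrite -subTset => /subsetPn[y _ yM].
have [yA|yA] := boolP (y \in A); first exact: mark_active settA yA yM.
have [MA clA served] := settA.
have [||||//|[B sB settB]] := @propagate M (y |: A) y.
- by apply: (subset_trans MA); apply: subsetUr.
- by rewrite !inE eqxx.
- by move=> u /setU1P[->|uA _]; rewrite ?eqxx // !inE clA ?orbT.
- by rewrite setU1K.
- by apply: mark_active settB _ yM; rewrite (subsetP sB) // !inE eqxx.
Qed.

Lemma reply A M x :
  settled A M -> x \notin M -> x |: M != [set: V] -> marking_move (x |: M).
Proof.
move=> settA xM notall; have [MA clA served] := settA.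
have [xA|xA] := boolP (x \in A).
  exact: free_move (settled_mark settA xA) notall.
have [||||//|[B _ settB]] := @propagate (x |: M) (x |: A) x.
- exact: setUS.
- by rewrite !inE eqxx.
- by move=> u /setU1P[->|uA _]; rewrite ?eqxx // !inE clA ?orbT.
- by rewrite setU1K // => v; rewrite !inE negb_or => /andP[_]; apply: served.
- exact: free_move settB notall.
Qed.

Lemma settled0 : settled set0 set0.
Proof.
split=> [|u|v _]; rewrite ?sub0set ?inE //.
rewrite /served_by (_ : [set u in _ | _] = set0) ?cards0 //.
by apply/setP => u; rewrite !inE.
Qed.

Lemma opponent_marks A M x :
  settled A M -> x \notin M -> marked_nbrs M x <= 4.
Proof.
move=> [MA _ served] xM.
by rewrite (leq_trans (marked_nbrs_le (k := 0) MA xM _)) ?addn0 ?served.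
Qed.

Definition marked (h : seq V) : {set V} := [set x in h].

Lemma marked_rcons h x : marked (rcons h x) = x |: marked h.
Proof. by apply/setP => u; rewrite !inE mem_rcons inE. Qed.

Lemma marked_before_prefix h x s : uniq (h ++ x :: s) ->
  marked_before e (h ++ x :: s) x = marked_nbrs (marked h) x.
Proof.
rewrite cat_uniq /= negb_or => /and4P[uh /andP[xh _] xs us].
rewrite /marked_before /marked_nbrs -cardsE; apply: eq_card => u.
rewrite !inE andbC; congr (_ && _).
rewrite !index_cat (negPf xh) /= eqxx addn0.
by case: ifP => uh'; rewrite ?index_mem // ltnNge leq_addr.
Qed.

Lemma activation_guarantees : alice_guarantees e 5.
Proof.
pose good h m := [/\ m \notin h, marked_nbrs (marked h) m <= 4 &
  exists A, settled A (m |: marked h)].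
(* At Alice's turns in a play that follows [sigma] a good move always exists; the default value
   makes [sigma] legal elsewhere. *)
pose sigma (h : seq V) : option V :=
  if [pick m | `[< good h m >]] is Some m then Some m else [pick m | m \notin h].
have sigma_good h m : good h m -> exists2 m', sigma h = Some m' & good h m'.
  move=> hm; rewrite /sigma; case: pickP => [m' /asboolP hm'|/(_ m)].
    by exists m'.
  by move/asboolP.
have marked_full h : uniq h -> size h < #|V| -> marked h != [set: V].
  move=> uh lt_h; apply: contraTneq lt_h => hT.
  by rewrite -cardsT -hT cardsE (card_uniqP uh) ltnn.
exists sigma.
  move=> h uh lt_h _; rewrite /sigma; case: pickP => [m /asboolP[mh _ _]|_].
    by exists m.
  have := marked_full h uh lt_h; rewrite -subTset => /subsetPn[y _].
  rewrite inE => yh; case: pickP => [m|/(_ y)]; first by exists m.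
  by rewrite yh.
move=> p [up sp] fol.
pose ok h := exists A, settled A (marked h).
(* Induction over the prefixes of the play: after Alice's moves (odd size) the invariant holds, and
   when she is to move a suitable vertex exists. *)
have step h s : p = h ++ s ->
    (if odd (size h) then ok h
     else marked h != [set: V] -> marking_move (marked h)) /\
    {in h, forall v, marked_before e p v <= 4}.
  elim/last_ind: h s => [|h x IH] s ps.
    split=> //; rewrite (_ : marked [::] = set0); last first.
      by apply/setP => u; rewrite !inE.
    exact: free_move settled0.
  have ph : p = h ++ x :: s by rewrite ps cat_rcons.
  have := up; rewrite {1}ph cat_uniq /= negb_or => /and4P[uh /andP[xh _] _ _].
  have lt_h : size h < #|V| by rewrite -sp ph size_cat /= addnS ltnS leq_addr.
  have [inv le4] := IH _ ph.
  have le4x : marked_nbrs (marked h) x <= 4 ->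
      {in rcons h x, forall v, marked_before e p v <= 4}.
    move=> le4x v; rewrite mem_rcons inE => /predU1P[->|/le4//].
    by rewrite ph marked_before_prefix -?ph.
  rewrite size_rcons marked_rcons /=; case: ifP inv => /= odd_h inv.
    have [A settA] := inv.
    have xM : x \notin marked h by rewrite inE.
    split; first by move=> xT; apply: reply settA xM xT.
    by apply: le4x; apply: opponent_marks settA xM.
  have [m [A [mM lem settA]]] := inv (marked_full h uh lt_h).
  have [|x' sx' [_ lex' okx']] := sigma_good h m.
    by split=> //; [rewrite inE in mM|exists A].
  have : sigma h = Some x.
    by apply: fol; rewrite ?odd_h //; apply/prefixP; exists s.
  rewrite sx' => -[xx']; rewrite -xx'; split; last by rewrite xx' in lex' *; apply: le4x.
  by rewrite /ok marked_rcons.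
move=> v; rewrite addn1 ltnS; have [|_ ->//] := step p [::]; first by rewrite cats0.
have /subset_leqif_card[_] : marked p \subset [set: V] by apply: subsetT.
rewrite cardsT cardsE (card_uniqP up) sp eqxx => /esym/subsetP/(_ v).
by rewrite !inE; apply.
Qed.
End Activation.

(** * Hall's theorem and the choice of servers *)

Section Hall.
Variables (L T : finType).
Implicit Types (r : L -> {set T}) (A : {set L}).

Definition hall r := forall A, #|A| <= #|\bigcup_(a in A) r a|.

Lemma hall_marriage r : hall r ->
  exists2 g : L -> T, injective g & forall a, g a \in r a.
Proof.
(* Rado's proof: as long as some [r a] has two elements, one of them can be
   removed without violating Hall's condition. *)
have [k] := ubnP (\sum_a #|r a|); elim: k => // k IH in r *.
rewrite ltnS => le_k hr.
have r_gt0 a : 0 < #|r a| by have := hr [set a]; rewrite cards1 big_set1.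
have [/existsP[a /card_gt1P[b1 [b2 [rb1 rb2 b12]]]]|] :=
    boolP [exists a, 1 < #|r a|]; last first.
  rewrite negb_exists => /forallP r_le1.
  have r1 a : {b | r a = [set b]}.
    apply: cid; have /cards1P[b ->] : #|r a| == 1.
      by rewrite eqn_leq r_gt0 leqNgt r_le1.
    by exists b.
  exists (fun a => sval (r1 a)) => [a1 a2 eq_g|a].
    apply: contraTeq (hr [set a1; a2]) => a12.
    rewrite cards2 a12 bigcup_setU !big_set1 -ltnNge.
    by rewrite (svalP (r1 a1)) (svalP (r1 a2)) eq_g setUid cards1.
  by rewrite {2}(svalP (r1 a)) inE.
pose rem b a' := if a' == a then r a :\ b else r a'.
have rem_sub b a' : rem b a' \subset r a'.
  by rewrite /rem; case: eqP => [->|_] //; apply: subsetDl.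
have rem_lt b : b \in r a -> \sum_a' #|rem b a'| < k.
  move=> rb; apply: leq_trans le_k; rewrite (bigD1 a) //= [ltnRHS](bigD1 a) //=.
  rewrite -addSn {1}/rem eqxx leq_add //.
    by rewrite (cardsD1 b (r a)) rb.
  by apply: leq_sum => a' _; apply: subset_leq_card.
have reduce b : b \in r a -> hall (rem b) ->
    exists2 g : L -> T, injective g & forall a, g a \in r a.
  move=> rb /(IH _ (rem_lt _ rb))[g g_inj gP]; exists g => // a'.
  exact: (subsetP (rem_sub b a')).
have [h1|h1] := pselect (hall (rem b1)); first exact: (reduce b1).
have [h2|h2] := pselect (hall (rem b2)); first exact: (reduce b2).
(* A violating set must contain [a]; the set [B] is what remains of it without [a]. *)
have violation b : b \in r a -> ~ hall (rem b) -> exists B : {set L},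
    [/\ a \notin B & #|\bigcup_(a' in B) r a' :|: (r a :\ b)| <= #|B|].
  move=> rb /existsNP[A /negP]; rewrite -ltnNge => lt_A.
  have [aA|aA] := boolP (a \in A); last first.
    exfalso; move: lt_A; rewrite ltnNge (leq_trans (hr A)) //.
    apply/subset_leq_card/bigcupsP => a' a'A; apply: (bigcup_max a') => //.
    by rewrite /rem; case: eqP => // aa'; rewrite -aa' a'A in aA.
  exists (A :\ a); rewrite !inE eqxx; split => //.
  rewrite -ltnS; move: lt_A; rewrite (cardsD1 a A) aA add1n.
  apply: leq_ltn_trans; apply: subset_leq_card; rewrite subUset.
  apply/andP; split.
    apply/bigcupsP => a'; rewrite !inE => /andP[a'a a'A].
    by apply: (bigcup_max a') => //; rewrite /rem (negPf a'a).
  by apply: (bigcup_max a) => //; rewrite /rem eqxx.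
exfalso.
have [B1 [aB1 le1]] := violation b1 rb1 h1.
have [B2 [aB2 le2]] := violation b2 rb2 h2.
(* Submodularity: since [b1 != b2], the union of the two neighbourhoods covers that of
   [a |: (B1 :|: B2)], and their intersection covers that of [B1 :&: B2]. Hall's condition for these
   two sets exceeds the sum of the bounds by one. *)
have := leq_add le1 le2; rewrite -cardsUI -(cardsUI B1) leqNgt => /negP; apply.
have hU := hr (a |: (B1 :|: B2)); have hI := hr (B1 :&: B2).
rewrite cardsU1 !inE (negPf aB1) (negPf aB2) /= in hU.
rewrite -addSn; apply: leq_add.
  apply: leq_trans hU _; apply: subset_leq_card.
  apply/bigcupsP => a'; rewrite !inE => /or3P[/eqP->|aB|aB].
  - apply/subsetP => c rc; rewrite !inE rc !andbT.
    by have [->|] := eqVneq c b1; rewrite ?b12 ?orbT.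
  - apply/subsetP => c rc; rewrite !inE; apply/orP; left; apply/orP; left.
    by apply/bigcupP; exists a'.
  - apply/subsetP => c rc; rewrite !inE; apply/orP; right; apply/orP; left.
    by apply/bigcupP; exists a'.
apply: leq_trans hI _; apply: subset_leq_card.
apply/bigcupsP => a'; rewrite !inE => /andP[aB1' aB2'].
apply/subsetP => c rc; rewrite !inE; apply/andP; split; apply/orP; left.
  by apply/bigcupP; exists a'.
by apply/bigcupP; exists a'.
Qed.
End Hall.

(** * Servers obtained from sparsity *)

Section Service.
Variables (V : finType) (e : rel V).
Hypothesis e_sym : symmetric e.

Definition deg (e' : rel V) v := #|[set u | e' v u]|.

(* Since the degrees add up to twice the number of edges, this bounds the number
   of edges of every subgraph by 7/5 of its number of nonisolated vertices. *)
Definition sparse := forall e' : rel V, symmetric e' -> subrel e' e ->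
  5 * \sum_v deg e' v <= 14 * #|[set v | 0 < deg e' v]|.

Definition closed_nbhd v := [set u | e v u || (u == v)].

(** Vertices outside [X] with exactly one neighbour in [X] (the set [Y1]) add one to each side, so
    the count reduces to [W], where sparsity applies to [e']. *)
Lemma sum_deg_le (X : {set V}) : sparse -> (forall v, v \in X -> 1 < deg e v) ->
  \sum_(v in X) (deg e v - 2) <= #|\bigcup_(v in X) closed_nbhd v|.
Proof.
move=> sp X2.
pose dX u := #|[set v in X | e u v]|.
pose W := X :|: [set u | 1 < dX u].
pose e' u v := [&& e u v, u \in W, v \in W & (u \in X) || (v \in X)].
have e'_sym : symmetric e'.
  by move=> u v; rewrite /e' e_sym orbC; congr (_ && _); rewrite andbCA.
have dXE u : dX u = \sum_(v in X) e u v.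
  by rewrite /dX -sum1_card big_mkcond [RHS]big_mkcond /=; apply: eq_bigr => v _;
    rewrite !inE; case: (v \in X) (e u v) => [] [].
have := sp e' e'_sym (fun u v h => proj1 (andP h)).
have supp : #|[set v | 0 < deg e' v]| <= #|W|.
  apply: subset_leq_card; apply/subsetP => u; rewrite inE => /card_gt0P[v].
  by rewrite inE => /and3P[].
have degX : \sum_(v in X) deg e v = \sum_u dX u.
  under [RHS]eq_bigr do rewrite dXE.
  rewrite exchange_big /=; apply: eq_bigr => v _.
  rewrite /deg -sum1_card big_mkcond /=; apply: eq_bigr => u _.
  by rewrite inE e_sym; case: (e _ _).
have sum_e' : \sum_v deg e' v =
    \sum_(u in X) dX u + 2 * \sum_(u in W :\: X) dX u.
  rewrite (bigID (mem X)) /= mul2n -addnn addnA; congr (_ + _).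
    have -> : \sum_(u in X) deg e' u = \sum_(u in X) \sum_(v in W) e u v.
      apply: eq_bigr => u uX; rewrite /deg -sum1_card big_mkcond [RHS]big_mkcond /=.
      apply: eq_bigr => v _; rewrite inE /e' uX inE uX /= andbT.
      by case: (e u v); case: (v \in W).
    rewrite exchange_big /= (eq_bigr dX) => [|v _]; last first.
      by rewrite dXE; apply: eq_bigr => u _; rewrite e_sym.
    rewrite (bigID (mem X)) /=; congr (_ + _); apply: eq_bigl => v.
      by rewrite !inE; case: (v \in X); rewrite ?orbT ?andbF.
    by rewrite !inE; case: (v \in X); rewrite ?orbT ?andbF ?andbT.
  rewrite (bigID (mem W)) /= [X in _ + X]big1 ?addn0; last first.
    move=> u /andP[_ uW]; apply/eqP; rewrite cards_eq0; apply/eqP/setP => v.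
    by rewrite !inE /e' (negPf uW) andbF.
  apply: eq_big => u; first by rewrite !inE.
  case/andP=> uX uW; rewrite /deg /dX; apply: eq_card => v; rewrite !inE /e' uW.
  by rewrite (negPf uX) inE; case: (v \in X); rewrite ?andbF ?andbT.
have X2sum : \sum_(v in X) deg e v = \sum_(v in X) (deg e v - 2) + 2 * #|X|.
  by rewrite mulnC -sum_nat_const -big_split /=; apply: eq_bigr => v /X2 h; rewrite subnK.
have splitW : \sum_u dX u =
    \sum_(u in X) dX u + \sum_(u in W :\: X) dX u + \sum_(u in ~: W) dX u.
  rewrite (bigID (mem W)) /=; congr (_ + _); last first.
    by apply: eq_bigl => u; rewrite in_setC.
  rewrite (bigID (mem X)) /=; congr (_ + _); apply: eq_bigl => u; rewrite !inE.
    by case: (u \in X); rewrite ?andbT ?andbF.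
  by case: (u \in X); rewrite ?andbT ?andbF.
have WX : #|W| = #|X| + #|W :\: X|.
  by rewrite -(cardsID X W); congr (#|pred_of_set _| + _); apply/setIidPr/subsetUl.
have W2 : 2 * #|W :\: X| <= \sum_(u in W :\: X) dX u.
  rewrite mulnC -sum_nat_const; apply: leq_sum => u; rewrite !inE.
  by case/andP => /negPf -> /=.
pose Y1 := [set u in ~: W | 0 < dX u].
have Y1sum : \sum_(u in ~: W) dX u <= #|Y1|.
  rewrite -sum1_card [leqRHS]big_mkcond [leqLHS]big_mkcond; apply: leq_sum => u _.
  rewrite [u \in Y1]inE; case: ifP => //=; rewrite !inE negb_or -leqNgt.
  by case/andP => _; case: (dX u) => [|[]].
have cover : #|W| + #|Y1| <= #|\bigcup_(v in X) closed_nbhd v|.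
  rewrite -cardsUI [_ :&: _](_ : _ = set0) ?cards0 ?addn0; last first.
    by apply/setP => u; rewrite !inE; case: (_ || _).
  apply: subset_leq_card; apply/subsetP => u.
  have dX_cov : 0 < dX u -> u \in \bigcup_(v in X) closed_nbhd v.
    case/card_gt0P => v; rewrite !inE => /andP[vX euv]; apply/bigcupP.
    by exists v; rewrite // inE e_sym euv.
  rewrite !inE => /orP[/orP[uX|/ltnW//]|/andP[_ //]].
  by apply/bigcupP; exists u; rewrite // inE eqxx orbT.
(* With s and t the sums of [dX] over [X] and [W :\: X], sparsity reads 5 s + 10 t <= 14 #|W|; as t
   >= 2 #|W :\: X|, this gives s + t <= 3 #|X| + #|W :\: X|. *)
move: supp degX sum_e' X2sum splitW WX W2 Y1sum cover.
move: (\sum_(v in X) (deg e v - 2)) => a; lia.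
Qed.

Lemma service : sparse ->
  exists f : V -> V, forall v, #|[pred u | (e u v || (u == v)) && (f u != v)]| <= 3.
Proof.
move=> sp.
(* Each [v] asks for [deg e v - 2] servers in its closed neighbourhood of at most [deg e v + 1]
   vertices, so that at most three remain. Vertices of degree at most two ask for none. *)
pose L : finType := {v : V & 'I_(deg e v - 2)}.
pose lab v i : L := Tagged (fun v => 'I_(deg e v - 2)) (i : 'I_(deg e v - 2)).
have [|g g_inj gP] := @hall_marriage L V (fun a => closed_nbhd (tag a)).
  move=> A; pose X := [set v in [set tag a | a in A] | 1 < deg e v].
  have /(sum_deg_le sp) le v : v \in X -> 1 < deg e v by rewrite inE => /andP[].
  apply: leq_trans (_ : \sum_(v in X) (deg e v - 2) <= _).
    rewrite -sum1_card (partition_big (fun a : L => tag a) (mem X)) /=; last first.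
      case=> v i aA; rewrite inE.
      apply/andP; split; first by apply/imsetP; exists (lab v i).
      by have := ltn_ord i; rewrite /=; lia.
    apply: leq_sum => v _.
    rewrite -[leqRHS]card_ord sum1_card.
    apply: leq_trans (_ : #|[set lab v i | i in [set: 'I_(deg e v - 2)]]| <= _).
      apply: subset_leq_card; apply/subsetP; case=> w i /andP[_ /eqP wv].
      by case: v / wv; apply: (imset_f (lab w)); rewrite inE.
    by rewrite (leq_trans (leq_imset_card _ _)) // cardsT.
  apply: leq_trans le _; apply: subset_leq_card; apply/bigcupsP => v.
  rewrite inE => /andP[/imsetP[a aA ->] _]; exact: (bigcup_max a).
(* An unmatched vertex serves itself. *)
pose f u := if [pick a | g a == u] is Some a then tag a else u.
exists f => v.
pose S := [set g (lab v i) | i in [set: 'I_(deg e v - 2)]].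
have cardS : #|S| = deg e v - 2.
  rewrite card_imset ?cardsT ?card_ord // => i j /g_inj/eqP.
  by rewrite eq_Tagged => /eqP.
have SN : S \subset closed_nbhd v.
  by apply/subsetP => u /imsetP[i _ ->]; apply: gP.
have fS u : u \in S -> f u = v.
  case/imsetP => i _ ->; rewrite /f; case: pickP => [a /eqP/g_inj -> //|].
  by move/(_ (lab v i)); rewrite eqxx.
apply: leq_trans (_ : #|closed_nbhd v :\: S| <= _).
  apply: subset_leq_card; apply/subsetP => u; rewrite !inE e_sym => /andP[-> fu].
  by rewrite andbT; apply: contra fu => /fS ->.
rewrite cardsD (setIidPr SN) cardS.
have : #|closed_nbhd v| <= deg e v + 1.
  rewrite -(cards1 v) -cardsUI; apply: leq_trans (leq_addr _ _).
  by apply: subset_leq_card; apply/subsetP => u; rewrite !inE.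
lia.
Qed.
End Service.

(** * Even edge sets and faces *)

Lemma odd_card (T : finType) (A : {set T}) (b : pred T) :
  odd #|[set x in A | b x]| = \big[addb/false]_(x in A) b x.
Proof.
rewrite -sum1_card (big_morph odd oddD (erefl _)) /= [LHS]big_mkcond.
rewrite [RHS]big_mkcond; apply: eq_bigr => x _; rewrite inE.
by case: (x \in A); case: (b x).
Qed.

Section CycleSpace.
Variable V : finType.
Implicit Types (C D E : {set V * V}) (p q : V * V) (u v : V).

(* An edge is given with one of its two orientations. *)
Definition ends p u := (p.1 == u) (+) (p.2 == u).

Definition boundary C := [set u | \big[addb/false]_(p in C) ends p u].

(* Sums over [addb] compute in the field with two elements. *)
Definition symdiff C D := [set p | (p \in C) (+) (p \in D)].

Lemma sum_symdiff C D (b : pred (V * V)) :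
  \big[addb/false]_(p in symdiff C D) b p =
  \big[addb/false]_(p in C) b p (+) \big[addb/false]_(p in D) b p.
Proof.
rewrite [LHS]big_mkcond [X in _ = X (+) _]big_mkcond [X in _ = _ (+) X]big_mkcond.
rewrite -big_split; apply: eq_bigr => p _; rewrite inE.
by case: (p \in C); case: (p \in D) => //=; rewrite ?addbb ?addbF.
Qed.

Lemma boundary_symdiff C D u :
  (u \in boundary (symdiff C D)) = (u \in boundary C) (+) (u \in boundary D).
Proof. by rewrite !inE sum_symdiff. Qed.

(** The cycle space of [E] over the field with two elements. *)
Definition cyclic_sets E := [set C : {set V * V} | (C \subset E) && (boundary C == set0)].

Lemma boundary0P C u :
  boundary C = set0 -> \big[addb/false]_(p in C) ends p u = false.
Proof. by move/setP/(_ u); rewrite !inE. Qed.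

Lemma cyclic_symdiff E C D : C \in cyclic_sets E -> D \in cyclic_sets E ->
  symdiff C D \in cyclic_sets E.
Proof.
rewrite !inE => /andP[CE /eqP bC] /andP[DE /eqP bD]; apply/andP; split.
  apply/subsetP => p; rewrite inE; case: (boolP (p \in C)) => [/(subsetP CE)//|_].
  exact: (subsetP DE).
by apply/eqP/setP => u; rewrite boundary_symdiff bC bD !inE.
Qed.

(** Rank-nullity for [boundary]: each fibre over a subset of [W] is empty or, translated by one of
    its members, lies in the cycle space. *)
Lemma card_cyclic_sets E (W : {set V}) :
  (forall p, p \in E -> (p.1 \in W) /\ (p.2 \in W)) ->
  2 ^ #|E| <= #|cyclic_sets E| * 2 ^ #|W|.
Proof.
move=> EW; rewrite -!card_powerset mulnC -sum_nat_const.
rewrite -[leqLHS]sum1_card (partition_big boundary (mem (powerset W))) /=; last first.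
  move=> C; rewrite powersetE => CE; rewrite inE; apply/subsetP => u; rewrite inE.
  apply: contraLR => uW; rewrite big1 // => p pC.
  have [p1 p2] := EW p (subsetP CE _ pC).
  have neq v : v \in W -> (v == u) = false by apply: contraTF => /eqP ->.
  by rewrite /ends !neq.
apply: leq_sum => U _; pose S := [set C in powerset E | boundary C == U].
rewrite (_ : \sum_(_ | _) 1 = #|S|); last first.
  by rewrite -sum1_card; apply: eq_bigl => C; rewrite !inE.
have [->|[C0 SC0]] := set_0Vmem S; first by rewrite cards0.
apply: leq_trans (_ : #|[set symdiff C C0 | C in S]| <= _).
  rewrite card_imset // => C D /setP eqCD; apply/setP => p.
  by have := eqCD p; rewrite !inE => /addIb.
apply: subset_leq_card; apply/subsetP => _ /imsetP[C SC ->].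
move: SC0 SC; rewrite !inE.
move=> /andP[C0E /eqP bC0] /andP[CE /eqP bC]; apply/andP; split.
  apply/subsetP => p; rewrite inE; case: (boolP (p \in C)) => [/(subsetP CE)//|_].
  exact: (subsetP C0E).
by apply/eqP/setP => u; rewrite boundary_symdiff bC bC0 inE addbb.
Qed.

(** * Counting faces: a weak form of Euler's formula *)

Section Faces.
Variables (E : {set V * V}) (W : {set V}) (girth : nat).
(** The faces on the two sides of an edge. A face stands for a linear form on the cycle space, given
    by the cyclic sets on which it equals one. *)
Variables (left right : V * V -> {set {set V * V}}).
Hypothesis EW : forall p, p \in E -> (p.1 \in W) /\ (p.2 \in W).
Hypothesis sides : forall C p, C \in cyclic_sets E -> p \in E ->
  (C \in left p) (+) (C \in right p) = (p \in C).
(* In a drawing this is seen by turning around the vertex [u]. *)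
Hypothesis rotation : forall u face, \big[addb/false]_(p in E)
  (ends p u && ((left p == face) (+) (right p == face))) = false.
Hypothesis girthP : forall C, C \in cyclic_sets E -> C != set0 -> girth <= #|C|.

Let face_boundary face := [set p in E | (left p == face) (+) (right p == face)].
Let faces := [set face | face_boundary face != set0].

Let face_boundary_cyclic face : face_boundary face \in cyclic_sets E.
Proof.
rewrite inE; apply/andP; split; first by apply/subsetP => p; rewrite inE => /andP[].
apply/eqP/setP => u; rewrite inE [RHS]inE -[RHS](rotation u face).
rewrite [LHS]big_mkcond [RHS]big_mkcond; apply: eq_bigr => p _; rewrite inE.
by case: (p \in E) => //=; case: (_ (+) (_ == face)); rewrite ?andbT ?andbF.
Qed.

(** Double counting: a nonempty face boundary is a cyclic set, hence has at least [girth] edges, and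
    an edge lies on at most two boundaries. *)
Let card_faces : girth * #|faces| <= 2 * #|E|.
Proof.
rewrite mulnC -sum_nat_const.
apply: leq_trans (_ : \sum_(face in faces) #|face_boundary face| <= _).
  by apply: leq_sum => face; rewrite inE => /girthP; apply.
apply: leq_trans (_ : \sum_face #|face_boundary face| <= _).
  by rewrite [leqRHS](bigID (mem faces)) leq_addr.
rewrite mulnC -sum_nat_const.
have -> : \sum_face #|face_boundary face| =
    \sum_(p in E) \sum_face ((left p == face) (+) (right p == face)).
  rewrite exchange_big /=; apply: eq_bigr => face _.
  rewrite -sum1_card big_mkcond [RHS]big_mkcond; apply: eq_bigr => p _.
  by rewrite inE; case: (p \in E) => //=; case: (_ (+) _).
apply: leq_sum => p _.
apply: leq_trans (_ : \sum_face ((left p == face) + (right p == face)) <= _).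
  by apply: leq_sum => face _; case: (_ == _); case: (_ == _).
have sum1 (f0 : {set {set V * V}}) : \sum_face (f0 == face) = 1.
  rewrite (bigD1 f0) //= eqxx big1 // => face; rewrite eq_sym.
  by move/negPf->.
by rewrite big_split /= !sum1.
Qed.

(** A cyclic set [C] is determined by the faces containing it: by [sides], [p] is in [C] when
    exactly one of [left p] and [right p] contains [C]. *)
Let card_cyclic_faces : #|cyclic_sets E| <= 2 ^ #|faces|.
Proof.
rewrite -card_powerset.
rewrite -(card_in_imset (f := fun C => [set face in faces | C \in face])).
  by apply: subset_leq_card; apply/subsetP => _ /imsetP[C _ ->];
    rewrite inE; apply/subsetP => face; rewrite inE => /andP[].
move=> C D cC cD /setP eqCD; apply/setP => p.
have [pE|pE] := boolP (p \in E); last first.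
  move: cC cD; rewrite !inE => /andP[/subsetP CE _] /andP[/subsetP DE _].
  by rewrite (contraNF (CE p)) ?(contraNF (DE p)).
rewrite -(sides cC pE) -(sides cD pE).
have [->|lr] := eqVneq (left p) (right p); first by rewrite !addbb.
have lF : left p \in faces.
  by rewrite inE; apply/set0Pn; exists p; rewrite inE pE eqxx eq_sym (negPf lr).
have rF : right p \in faces.
  by rewrite inE; apply/set0Pn; exists p; rewrite inE pE eqxx (negPf lr).
have := eqCD (left p); rewrite [LHS]inE [RHS]inE lF /= => ->.
by have := eqCD (right p); rewrite [LHS]inE [RHS]inE rF /= => ->.
Qed.

(** Comparing the two bounds on the cycle space gives [#|E| <= #|faces| + #|W|], and [card_faces]
    bounds the faces. *)
Lemma edge_bound : girth * #|E| <= 2 * #|E| + girth * #|W|.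
Proof.
have : 2 ^ #|E| <= 2 ^ (#|faces| + #|W|).
  rewrite expnD (leq_trans (card_cyclic_sets EW)) // leq_mul2r.
  by rewrite card_cyclic_faces orbT.
rewrite leq_exp2l // => le; apply: leq_trans (leq_mul (leqnn girth) le) _.
by rewrite mulnDr leq_add2r card_faces.
Qed.
End Faces.

(** * Cycles inside nonempty even sets *)

Section CyclicGirth.
Variable C : {set V * V}.
Hypothesis loopless : forall p, p \in C -> p.1 != p.2.
Hypothesis oriented : forall u v, (u, v) \in C -> (v, u) \notin C.
Hypothesis bC : boundary C = set0.

Let adj u v := ((u, v) \in C) || ((v, u) \in C).

Let adjC u v : adj u v = adj v u. Proof. exact: orbC. Qed.

(** The degree of [u] in [C] is even, so a second edge of [C] meets [u]; by [oriented] it is not the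
    reverse of the first. *)
Let other_neighbor u v : adj u v -> exists2 v', adj u v' & v' != v.
Proof.
move=> uv; pose p := if (u, v) \in C then (u, v) else (v, u).
have pC : p \in C by move: uv; rewrite /adj /p; case: ifP.
have pu : ends p u.
  have := loopless pC; rewrite /ends /p; case: ifP => _ /=.
    by rewrite eqxx eq_sym => /negPf ->.
  by rewrite eqxx => /negPf ->.
have := boundary0P u bC; rewrite (bigD1 p) //= pu addTb => /negbFE.
have [q /and3P[qC qp qu]|none] := pickP (fun q => [&& q \in C, q != p & ends q u]).
  move=> _; case: q qC qp qu => a b qC; rewrite /ends /=.
  have := loopless qC; rewrite /=.
  have [au|_] := eqVneq a u => ab qp /=.
    subst a => _; exists b; first by rewrite /adj qC.
    by apply: contraNneq qp => bv; subst b; rewrite /p qC.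
  move=> /eqP bu; subst b; exists a; first by rewrite /adj qC orbT.
  apply: contraNneq qp => av; subst a; rewrite /p.
  by rewrite (negPf (oriented qC)).
rewrite big1 // => q /andP[qC qp].
by apply/negP => qu; have := none q; rewrite qC qp qu.
Qed.

(** A second neighbour of the first vertex of a longest path lies on that path, since it would
    otherwise extend it; it closes a cycle. *)
Lemma cyclic_set_cycle : C != set0 ->
  exists2 c, graph_cycle adj c & {in c, forall u, exists v, adj u v}.
Proof.
move=> /set0Pn[[a b] abC].
have aab : adj a b by rewrite /adj abC.
have adj_irr u v : adj u v -> u != v.
  by case/orP => /loopless //=; rewrite eq_sym.
pose long n := [exists t : n.-tuple V,
  if tval t is x :: s then path adj x s && uniq (x :: s) else false].
have long2 : exists n, long n.
  exists 2; apply/existsP; exists [tuple a; b] => /=.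
  by rewrite aab /= inE adj_irr.
have long_max n : long n -> n <= #|V|.
  case/existsP => t; case: (tval t) (size_tuple t) => // x s <- /andP[_ us].
  by rewrite -(card_uniqP us) max_card.
case: (ex_maxnP long2 long_max) => n /existsP[t].
case: (tval t) (size_tuple t) => // x s sn /andP[xs us] max_n.
have n_ge2 : 2 <= n.
  by apply: max_n; apply/existsP; exists [tuple a; b] => /=; rewrite aab /= inE adj_irr.
case: s => [|y s] in xs us sn *; first by rewrite -sn in n_ge2.
have [xy ys] : adj x y /\ path adj y s by apply/andP.
have [y' xy' y'y] := other_neighbor xy.
have y's : y' \in s.
  apply: contraT => y's; suff : long n.+1 by move/max_n; rewrite ltnn.
  apply/existsP; exists (@Tuple _ _ [:: y', x, y & s] (introT eqP (congr1 succn sn))) => /=.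
  rewrite adjC xy' xy ys !inE (negPf y'y) (negPf y's) !orbF eq_sym.
  by rewrite (adj_irr _ _ xy'); move: us; rewrite /= inE.
case/splitPr: y's => s1 s2 in ys us sn xs.
have ec : path adj x (y :: rcons s1 y').
  by move: ys; rewrite /= xy cat_path rcons_path /= => /andP[-> /andP[-> _]].
exists [:: x, y & rcons s1 y'].
  split; first by rewrite /= size_rcons.
    have /subseq_uniq : subseq [:: x, y & rcons s1 y'] [:: x, y & s1 ++ y' :: s2].
      by rewrite -cat_rcons /= !eqxx prefix_subseq.
    by apply.
  by rewrite /cycle rcons_path ec /= last_rcons adjC.
move=> u; rewrite inE => /predU1P[->|us1]; first by exists y.
case/splitPr: us1 ec => t1 t2; rewrite cat_path => /and3P[_ wu _].
by exists (last x t1); rewrite adjC.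
Qed.

(** Every vertex of the cycle meets at least two edges of [C], their number being even and positive,
    and an edge has two ends. *)
Lemma cyclic_set_card : C != set0 -> exists2 c, graph_cycle adj c & size c <= #|C|.
Proof.
move=> /cyclic_set_cycle[c cc c_adj]; exists c => //.
have [_ uc _] := cc.
rewrite -(card_uniqP uc) -(leq_pmul2l (m := 2)) // mulnC -sum_nat_const.
apply: leq_trans (_ : \sum_(u in c) #|[set p in C | ends p u]| <= _).
  apply: leq_sum => u /c_adj[v uv].
  have : odd #|[set p in C | ends p u]| = false by rewrite odd_card boundary0P.
  have : 0 < #|[set p in C | ends p u]|.
    have /orP[puv|puv] := uv; apply/card_gt0P.
      exists (u, v); rewrite inE puv /ends /= eqxx eq_sym.
      by rewrite (negPf (loopless puv)).
    by exists (v, u); rewrite inE puv /ends /= eqxx (negPf (loopless puv)).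
  by case: #|_| => [|[|]].
apply: leq_trans (_ : \sum_u #|[set p in C | ends p u]| <= _).
  by rewrite [leqRHS](bigID (mem c)) leq_addr.
have -> : \sum_u #|[set p in C | ends p u]| = \sum_(p in C) \sum_u ends p u.
  rewrite exchange_big /=; apply: eq_bigr => u _.
  rewrite -sum1_card big_mkcond [RHS]big_mkcond; apply: eq_bigr => p _.
  by rewrite inE; case: (p \in C) => //=; case: (ends _ _).
rewrite mulnC -sum_nat_const; apply: leq_sum => p _.
apply: leq_trans (_ : \sum_u ((p.1 == u) + (p.2 == u)) <= _).
  by apply: leq_sum => u _; rewrite /ends; case: (_ == _); case: (_ == _).
have sum1 (f0 : V) : \sum_u (f0 == u) = 1.
  by rewrite (bigD1 f0) //= eqxx big1 // => u; rewrite eq_sym => /negPf->.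
by rewrite big_split /= !sum1.
Qed.
End CyclicGirth.
End CycleSpace.

Import Order.TTheory GRing.Theory Num.Theory.

(** * Crossing parities *)

Section Crossing.
Local Open Scope ring_scope.
Variable R : realFieldType.
Implicit Types p q r a b z : R * R.

Definition on_seg (s : (R * R) * (R * R)) (z : R * R) : Prop :=
  exists2 t : R, 0 <= t <= 1 &
    z.1 = (1 - t) * s.1.1 + t * s.2.1 /\ z.2 = (1 - t) * s.1.2 + t * s.2.2.

Definition disjoint_segs s1 s2 := forall z, on_seg s1 z -> on_seg s2 z -> False.

Let det p q := p.1 * q.2 - q.1 * p.2.

(* The segment from [p] to [q] meets the ray from the origin in direction
   (1, 0); a point of the axis counts as lying above it. *)
Definition crosses p q : bool :=
  if p.2 < 0 then (0 <= q.2) && (0 < p.1 * q.2 - q.1 * p.2)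
  else (q.2 < 0) && (p.1 * q.2 - q.1 * p.2 < 0).

Lemma crossesC p q : crosses p q = crosses q p.
Proof.
rewrite /crosses; have [p0|p0] := ltP p.2 0; have [q0|q0] := ltP q.2 0 => //=.
  by rewrite -[q.1 * _ - _]opprB oppr_lt0.
by rewrite -[q.1 * _ - _]opprB oppr_gt0.
Qed.

(** The origin lies in the convex hull; the weights are not normalised, so that determinants can
    serve as weights. *)
Definition in_triangle p q r := exists a b c : R,
  [/\ 0 <= a, 0 <= b, 0 <= c, 0 < a + b + c &
    a * p.1 + b * q.1 + c * r.1 = 0 /\ a * p.2 + b * q.2 + c * r.2 = 0].

Lemma in_triangle_rot p q r : in_triangle p q r -> in_triangle q r p.
Proof.
move=> [a [b [c [a0 b0 c0 s0 [h1 h2]]]]]; exists b, c, a; split=> //; first lra.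
by split; lra.
Qed.

Lemma in_triangle_flip p q r : in_triangle p q r -> in_triangle p r q.
Proof.
move=> [a [b [c [a0 b0 c0 s0 [h1 h2]]]]]; exists a, c, b; split=> //; first lra.
by split; lra.
Qed.

(** The weights come from the Cramer identity [det q r * p + det r p * q + det p q * r = 0], whose
    second coordinate gives the sign of [det q r]. *)
Let triangle_below p q r : p.2 < 0 -> 0 <= q.2 -> 0 <= r.2 ->
  0 < det p q -> det p r <= 0 -> in_triangle p q r.
Proof.
move=> p0 q0 r0 pq pr.
have E : det q r * - p.2 = - det p r * q.2 + det p q * r.2 by rewrite /det; ring.
have qr : 0 <= det q r.
  have : 0 <= det q r * - p.2.
    by rewrite E addr_ge0 // mulr_ge0 ?oppr_ge0 // ltW.
  by rewrite pmulr_lge0 // oppr_gt0.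
exists (det q r), (- det p r), (det p q); split; rewrite ?oppr_ge0 ?(ltW pq) //.
  by lra.
by split; rewrite /det; ring.
Qed.

Let triangle_above p q r : 0 <= p.2 -> q.2 < 0 -> r.2 < 0 ->
  det p q < 0 -> 0 <= det p r -> in_triangle p q r.
Proof.
move=> p0 q0 r0 pq pr.
have E : - det q r * p.2 = det p r * - q.2 + - det p q * - r.2 by rewrite /det; ring.
have qr : 0 < - det q r.
  have : 0 < - det q r * p.2.
    rewrite E ltr_wpDl ?mulr_ge0 ?mulr_gt0 ?oppr_gt0 ?oppr_ge0 // ltW //.
  rewrite !ltNge; apply: contra => h; exact: mulr_le0_ge0.
exists (- det q r), (det p r), (- det p q); split; try lra.
by split; rewrite /det; ring.
Qed.

(** Some two vertices lie on the same side of the axis. The side joining them misses the ray, and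
    the other two sides both cross it or both miss it, else the origin is in the triangle. *)
Lemma crosses_triangle p q r : ~ in_triangle p q r ->
  crosses p q (+) crosses q r (+) crosses r p = false.
Proof.
have detN u v : det u v = - det v u by rewrite /det; ring.
have lone u v w : ~ in_triangle u v w -> (u.2 < 0) != (v.2 < 0) ->
    (v.2 < 0) = (w.2 < 0) -> crosses u v = crosses u w.
  move=> nt uv vw; rewrite /crosses -/(det u v) -/(det u w).
  move: uv vw; have [u0|u0] := ltP u.2 0; have [v0|v0] := ltP v.2 0;
    have [w0|w0] := ltP w.2 0 => //= _ _.
    have [h1|h1] := ltP 0 (det u v); have [h2|h2] := ltP 0 (det u w) => //.
      by case: nt; apply: triangle_below.
    by case: nt; apply/in_triangle_flip/triangle_below.
  have [h1|h1] := ltP (det u v) 0; have [h2|h2] := ltP (det u w) 0 => //.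
    by case: nt; apply: triangle_above.
  by case: nt; apply/in_triangle_flip/triangle_above.
have same u v : (u.2 < 0) = (v.2 < 0) -> crosses u v = false.
  by rewrite /crosses => ->; have [] := ltP v.2 0.
move=> nt.
have [pq|pq] := eqVneq (p.2 < 0) (q.2 < 0).
  rewrite (same p q) //= (crossesC q r).
  have [qr|qr] := eqVneq (q.2 < 0) (r.2 < 0).
    by rewrite (crossesC r q) (crossesC r p) !same // pq.
  rewrite (lone r q p) ?addbb // 1?eq_sym //.
  by move/in_triangle_flip/in_triangle_rot; apply: nt.
have [qr|qr] := eqVneq (q.2 < 0) (r.2 < 0).
  by rewrite (same q r) // addbF (crossesC r p) (lone p q r) ?addbb.
have pr : (r.2 < 0) = (p.2 < 0) by move: pq qr; do 3!case: (_ < _).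
rewrite (same r p) // addbF (crossesC p q) (lone q p r) ?addbb // 1?eq_sym //.
by move/in_triangle_rot/in_triangle_flip; apply: nt.
Qed.

(** The four differences are the corners of a parallelogram, cut into two triangles by the diagonal
    from [a - z] to [b - z']. The origin in one of them would give a common point of the
    segments. *)
Lemma crosses_parallelogram a b z z' : disjoint_segs (a, b) (z, z') ->
  crosses (a - z) (b - z) (+) crosses (a - z') (b - z') =
  crosses (a - z) (a - z') (+) crosses (b - z) (b - z').
Proof.
move=> dis.
have meet (al be ga de : R) : 0 <= al -> 0 <= be -> 0 <= ga -> 0 <= de ->
    al + be = ga + de -> 0 < al + be ->
    al * a.1 + be * b.1 = ga * z.1 + de * z'.1 ->
    al * a.2 + be * b.2 = ga * z.2 + de * z'.2 -> False.
  move=> al0 be0 ga0 de0 sE s0 e1 e2.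
  have sN : al + be != 0 by rewrite gt_eqF.
  have sub (x y : R) : x + y = al + be -> 0 <= x -> 0 <= y -> 0 <= y / (al + be) <= 1.
    by move=> xy x0 y0; rewrite divr_ge0 ?(ltW s0) //= ler_pdivrMr // mul1r -xy; lra.
  have comb (x y u v : R) : x + y = al + be ->
      (1 - y / (al + be)) * u + y / (al + be) * v = (x * u + y * v) / (al + be).
    by move=> xy; rewrite (_ : x = al + be - y); [field|lra].
  apply: (dis ((al * a.1 + be * b.1) / (al + be), (al * a.2 + be * b.2) / (al + be))).
    by exists (be / (al + be)); rewrite ?(sub al) //= !(comb al).
  exists (de / (al + be)); first by rewrite (sub ga).
  by rewrite /= !(comb ga) // e1 e2.
have t1 : ~ in_triangle (a - z) (b - z) (b - z').
  move=> [x [y [t [x0 y0 t0 s0 /= [h1 h2]]]]].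
  by apply: (@meet x (y + t) (x + y) t); lra.
have t2 : ~ in_triangle (a - z) (b - z') (a - z').
  move=> [x [y [t [x0 y0 t0 s0 /= [h1 h2]]]]].
  by apply: (@meet (x + t) y x (y + t)); lra.
have := crosses_triangle t1; have := crosses_triangle t2.
rewrite (crossesC (b - z') (a - z)) (crossesC (b - z') (a - z')).
rewrite (crossesC (a - z') (a - z)).
by do 5!case: (crosses _ _).
Qed.

End Crossing.

(** * Polygonal drawings *)

Section PolygonalDrawing.
Local Open Scope ring_scope.
Variables (R : realFieldType) (V : finType) (E : {set V * V}).
Variables (pos : V -> R * R) (start : V * V -> R * R) (mid : V * V -> seq (R * R)).
Implicit Types (p q : V * V) (u v : V) (z a b : R * R) (d : (V * V) * bool).
Implicit Types (C : {set V * V}) (s : bool) (t x : R).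

(* The edge [p] is drawn as a polygonal line
   [pos p.1, start p, mid p, pos p.2].  A dart [(p, false)] (resp. [(p, true)])
   stands for the first (resp. last) segment of that line. *)
Definition finish p := last (start p) (mid p).
Definition mids p := pairmap pair (start p) (mid p).
Definition base d := if d.2 then d.1.2 else d.1.1.
Definition tip d := if d.2 then finish d.1 else start d.1.
Definition ray d := (pos (base d), tip d).

Definition winding p z :=
  crosses (pos p.1 - z) (start p - z) (+)
  \big[addb/false]_(m <- mids p) crosses (m.1 - z) (m.2 - z) (+)
  crosses (pos p.2 - z) (finish p - z).

Definition wind C z := \big[addb/false]_(p in C) winding p z.

(* Change of the crossing parity of the segment [s] between [z] and [z'],
   corrected by one term for each endpoint; these terms cancel out along a
   closed line. *)
Definition defect (s : (R * R) * (R * R)) z z' :=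
  crosses (s.1 - z) (s.2 - z) (+) crosses (s.1 - z') (s.2 - z') (+)
  (crosses (s.1 - z) (s.1 - z') (+) crosses (s.2 - z) (s.2 - z')).

Lemma defect_disjoint sg z z' : disjoint_segs sg (z, z') -> defect sg z z' = false.
Proof. by case: sg => a b /crosses_parallelogram; rewrite /defect /= => ->; rewrite addbb. Qed.

Definition turn p z z' :=
  defect (ray (p, false)) z z' (+)
  \big[addb/false]_(m <- mids p) defect m z z' (+)
  defect (ray (p, true)) z z'.

Let addb_cancel (a b A B ks kl k1 k2 c d : bool) :
  a (+) A (+) c (+) (b (+) B (+) d) =
  (a (+) b (+) (k1 (+) ks)) (+) (A (+) B (+) ks (+) kl) (+)
  (c (+) d (+) (k2 (+) kl)) (+) k1 (+) k2.
Proof. by move: a b A B ks kl k1 k2 c d; do 10 case. Qed.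

(** Each inner corner of the line contributes its correction term twice, so only the terms of the
    end vertices remain. *)
Lemma winding_turn p z z' : winding p z (+) winding p z' =
  turn p z z' (+) crosses (pos p.1 - z) (pos p.1 - z') (+)
  crosses (pos p.2 - z) (pos p.2 - z').
Proof.
rewrite /winding /turn /mids /finish /ray /base /tip /= /finish.
have : \big[addb/false]_(m <- pairmap pair (start p) (mid p)) defect m z z' =
  \big[addb/false]_(m <- pairmap pair (start p) (mid p)) crosses (m.1 - z) (m.2 - z) (+)
  \big[addb/false]_(m <- pairmap pair (start p) (mid p)) crosses (m.1 - z') (m.2 - z') (+)
  crosses (start p - z) (start p - z') (+)
  crosses (last (start p) (mid p) - z) (last (start p) (mid p) - z').
  elim: (mid p) (start p) => [|b l IH] a /=; first by rewrite !big_nil /= addbb.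
  rewrite !big_cons IH /defect /=.
  move: (\big[_/_]_(_ <- _) _) (\big[_/_]_(_ <- _) _) => A B.
  by case: A; case: B; do 5!case: (crosses _ _).
by move=> ->; rewrite /defect /=; apply: addb_cancel.
Qed.

Lemma sum_ends C (k : V -> bool) : boundary C = set0 ->
  \big[addb/false]_(p in C) (k p.1 (+) k p.2) = false.
Proof.
move=> bC.
have kE p : k p.1 (+) k p.2 = \big[addb/false]_u (k u && ends p u).
  have one v : \big[addb/false]_u (k u && (v == u)) = k v.
    rewrite (bigD1 v) //= eqxx andbT big1 ?addbF // => u.
    by rewrite eq_sym => /negPf ->; rewrite andbF.
  rewrite -(one p.1) -(one p.2) -big_split; apply: eq_bigr => u _.
  by rewrite /ends; case: (k u).
rewrite (eq_bigr _ (fun p _ => kE p)) exchange_big big1 // => u _.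
rewrite -big_distrr /= boundary0P //; exact: andbF.
Qed.

Lemma wind_turn C z z' : boundary C = set0 ->
  wind C z (+) wind C z' = \big[addb/false]_(p in C) turn p z z'.
Proof.
move=> bC; rewrite /wind -big_split /= (eq_bigr _ (fun p _ => winding_turn p z z')).
rewrite (eq_bigr (fun p => turn p z z' (+) (crosses (pos p.1 - z) (pos p.1 - z') (+)
  crosses (pos p.2 - z) (pos p.2 - z')))); last by move=> p _; rewrite addbA.
rewrite big_split /= -[RHS]addbF; congr (_ (+) _).
exact: (@sum_ends C (fun u => crosses (pos u - z) (pos u - z'))).
Qed.

Hypothesis tip_height : forall d, d.1 \in E -> (tip d).2 != (pos (base d)).2.
Hypothesis mids_disjoint : forall p q m n, p \in E -> q \in E -> p != q ->
  m \in mids p -> n \in mids q -> disjoint_segs m n.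
Hypothesis ray_mids_disjoint : forall d q m, d.1 \in E -> q \in E -> d.1 != q ->
  m \in mids q -> disjoint_segs (ray d) m.
Hypothesis rays_disjoint : forall d d' z, d.1 \in E -> d'.1 \in E -> d.1 != d'.1 ->
  on_seg (ray d) z -> on_seg (ray d') z -> base d = base d' /\ z = pos (base d).

(* Seen from its base at height [h] above or below it, the dart [d] has abscissa
   [slope d * h]. *)
Definition slope d := ((tip d).1 - (pos (base d)).1) / `|(tip d).2 - (pos (base d)).2|.
Definition up d := (pos (base d)).2 < (tip d).2.

(** * Boxes around the vertices *)

Variables (rho eta M : R).
Hypothesis rho_gt0 : 0 < rho.
Hypothesis eta_gt0 : 0 < eta.
Hypothesis M_ge0 : 0 <= M.
Hypothesis slope_lt : forall d, d.1 \in E -> `|slope d| + eta <= M.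
Hypothesis rho_lt : forall d, d.1 \in E -> rho < `|(tip d).2 - (pos (base d)).2|.
(** By [slope_lt] and [rho_lt] a dart leaves the box of its base through the top or the bottom; by
    the hypotheses below, nothing else of the drawing enters the box. *)
Definition box u z := `|z.1 - (pos u).1| <= rho * M /\ `|z.2 - (pos u).2| <= rho.
Hypothesis box_mids : forall u p m z, p \in E -> m \in mids p ->
  box u z -> on_seg m z -> False.
Hypothesis box_rays : forall u d z, d.1 \in E ->
  box u z -> on_seg (ray d) z -> base d = u.
Hypothesis slope_gap : forall d d', d.1 \in E -> d'.1 \in E -> d != d' ->
  base d = base d' -> up d = up d' -> eta + eta < `|slope d - slope d'|.

(** A point on the top ([s = true]) or bottom line of the box, scaled so that a dart [d] of that
    direction at [u] passes through it for [t = slope d]. *)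
Let probe u s t : R * R := ((pos u).1 + rho * t, (pos u).2 + (-1) ^+ (~~ s) * rho).

Let ray_shape d z : d.1 \in E -> on_seg (ray d) z ->
  z.1 - (pos (base d)).1 = slope d * `|z.2 - (pos (base d)).2| /\
  (z.2 != (pos (base d)).2 -> up d = ((pos (base d)).2 < z.2)).
Proof.
move=> dE [l /andP[l0 l1] /= [-> ->]]; have := tip_height dE.
have lerp (x y : R) : (1 - l) * x + l * y - x = l * (y - x) by ring.
rewrite -subr_eq0 !lerp /slope /up; set h := (tip d).2 - _ => h0.
have hN : `|h| != 0 by rewrite normr_eq0.
split; first by rewrite [`|l * h|]normrM (ger0_norm l0); field.
rewrite -subr_eq0 lerp -/h mulf_eq0 negb_or => /andP[ln _].
by rewrite -[LHS]subr_gt0 -[RHS]subr_gt0 lerp pmulr_rgt0 // lt_def ln.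
Qed.

Let probe_seg u s t t' z : t <= t' -> on_seg (probe u s t, probe u s t') z ->
  exists2 x, t <= x <= t' & z = probe u s x.
Proof.
move=> tt' [l /andP[l0 l1] /= [z1 z2]]; exists ((1 - l) * t + l * t').
  by apply/andP; split; nra.
by apply/eqP; rewrite -pair_eqE /= z1 z2; apply/andP; split; apply/eqP; ring.
Qed.

Let probe_box u s t : `|t| <= M -> box u (probe u s t).
Proof.
move=> tM; rewrite /box /probe /=; split; rewrite addrAC subrr add0r.
  by rewrite normrM gtr0_norm // ler_pM2l.
by rewrite normrM normr_sign mul1r gtr0_norm.
Qed.

Let on_ray_probe d u s x : d.1 \in E -> `|x| <= M -> on_seg (ray d) (probe u s x) ->
  [/\ base d = u, up d = s & slope d = x].
Proof.
move=> dE xM on; have du := box_rays dE (probe_box u s xM) on.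
have [] := ray_shape dE on; rewrite du /probe /=.
rewrite [_ + rho * x - _]addrAC subrr add0r [_ + _ * rho - _]addrAC subrr add0r.
rewrite normrM normr_sign mul1r (gtr0_norm rho_gt0) mulrC => /mulIf.
rewrite (gt_eqF rho_gt0) => /(_ isT) <- sd; split=> //; rewrite sd.
  rewrite ltrDl; case: s {sd on}; rewrite ?expr0 ?expr1 ?mul1r ?mulN1r //.
  by rewrite oppr_gt0 ltNge ltW.
by rewrite -subr_eq0 addrAC subrr add0r mulf_neq0 ?signr_eq0 ?gt_eqF.
Qed.

Let norm_between t x t' : `|t| <= M -> `|t'| <= M -> t <= x <= t' -> `|x| <= M.
Proof. by rewrite !ler_norml => /andP[? ?] /andP[? ?] /andP[? ?]; apply/andP; split; lra. Qed.

Let level_defect_mid u s t t' q m : `|t| <= M -> `|t'| <= M -> t <= t' ->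
  q \in E -> m \in mids q -> defect m (probe u s t) (probe u s t') = false.
Proof.
move=> tM t'M tt' qE mq; apply: defect_disjoint => z onm /(probe_seg tt')[x xI zE].
by apply: (box_mids qE mq) onm; rewrite zE; apply/probe_box/(norm_between tM t'M).
Qed.

Let level_defect_ray u s t t' d : `|t| <= M -> `|t'| <= M -> t <= t' -> d.1 \in E ->
  (base d = u -> up d = s -> t <= slope d <= t' -> False) ->
  defect (ray d) (probe u s t) (probe u s t') = false.
Proof.
move=> tM t'M tt' dE out; apply: defect_disjoint => z onm /(probe_seg tt')[x xI zE].
move: onm; rewrite zE => /(on_ray_probe dE (norm_between tM t'M xI))[du ds dx].
by apply: out; rewrite ?dx.
Qed.

Let level_turn u s t t' q : `|t| <= M -> `|t'| <= M -> t <= t' -> q \in E ->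
  turn q (probe u s t) (probe u s t') =
  defect (ray (q, false)) (probe u s t) (probe u s t') (+)
  defect (ray (q, true)) (probe u s t) (probe u s t').
Proof.
move=> tM t'M tt' qE; rewrite /turn big1_seq ?addbF // => m /andP[_ mq].
exact: (level_defect_mid _ _ tM t'M tt' qE mq).
Qed.

(** Both probes have the same height, so the corrections vanish; the horizontal ray meets the dart
    from the left probe only. *)
Let crossing_defect d t t' : d.1 \in E -> t < slope d < t' ->
  defect (ray d) (probe (base d) (up d) t) (probe (base d) (up d) t') = true.
Proof.
move=> dE /andP[]; have := rho_lt dE; have := tip_height dE.
rewrite /defect /ray /probe /slope /up /=.
case: (pos (base d)) (tip d) => [u1 u2] [a1 a2] /=.
rewrite -subr_eq0; set dx := a1 - u1; set dy := a2 - u2 => dy0 h3.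
rewrite /crosses /= -(subr_gt0 u2) -/dy.
have [dy_lt|dy_gt|//] := ltgtP dy 0; last by move=> e; rewrite e eqxx in dy0.
  rewrite ltr0_norm // in h3 *.
  rewrite ltr_pdivlMr ?oppr_gt0 // ltr_pdivrMr ?oppr_gt0 // => h1 h2.
  rewrite expr1 !mulN1r.
  have -> : u2 - (u2 - rho) = rho by ring.
  have -> : a2 - (u2 - rho) = dy + rho by rewrite /dy; ring.
  have n2 : dy + rho < 0 by lra.
  rewrite n2 [rho < 0]ltNge (ltW rho_gt0) /= [0 <= _ + _]leNgt n2 /= addbF.
  have -> : (u1 - (u1 + rho * t)) * (dy + rho) - (a1 - (u1 + rho * t)) * rho =
    - (rho * (dx - t * - dy)) by rewrite /dx; ring.
  have -> : (u1 - (u1 + rho * t')) * (dy + rho) - (a1 - (u1 + rho * t')) * rho =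
    rho * (t' * - dy - dx) by rewrite /dx; ring.
  rewrite oppr_lt0 pmulr_rgt0 // subr_gt0 h1 pmulr_rlt0 // subr_lt0.
  by rewrite ltNge (ltW h2).
rewrite gtr0_norm // in h3 *.
rewrite ltr_pdivlMr // ltr_pdivrMr // => h1 h2.
rewrite expr0 !mul1r.
have -> : u2 - (u2 + rho) = - rho by ring.
have -> : a2 - (u2 + rho) = dy - rho by rewrite /dy; ring.
have n2 : 0 <= dy - rho by lra.
rewrite n2 [- rho < 0]oppr_lt0 rho_gt0 /= [0 <= - rho]leNgt oppr_lt0 rho_gt0 /=.
rewrite [dy - rho < 0]ltNge n2 /= addbF.
have -> : (u1 - (u1 + rho * t)) * (dy - rho) - (a1 - (u1 + rho * t)) * - rho =
  rho * (dx - t * dy) by rewrite /dx; ring.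
have -> : (u1 - (u1 + rho * t')) * (dy - rho) - (a1 - (u1 + rho * t')) * - rho =
  - (rho * (t' * dy - dx)) by rewrite /dx; ring.
rewrite pmulr_rgt0 // subr_gt0 h1 oppr_gt0 pmulr_rlt0 // subr_lt0.
by rewrite ltNge (ltW h2).
Qed.

(* The linear form w(., z), encoded by the even sets on which it equals one. *)
Let face z := [set C in cyclic_sets E | wind C z].

Let face_eq z z' : (forall q, q \in E -> turn q z z' = false) -> face z = face z'.
Proof.
move=> h; apply/setP => C; rewrite /face !inE.
have [/andP[CE /eqP bC]|//] := boolP ((C \subset E) && _).
have := wind_turn z z' bC; rewrite big1 => [|q qC]; first by do 2!case: (wind _ _).
by apply/h/(subsetP CE).
Qed.

Let face_level u s t t' : `|t| <= M -> `|t'| <= M -> t <= t' ->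
  (forall d, d.1 \in E -> base d = u -> up d = s -> t <= slope d <= t' -> False) ->
  face (probe u s t) = face (probe u s t').
Proof.
move=> tM t'M tt' out; apply: face_eq => q qE; rewrite level_turn //.
by rewrite !level_defect_ray //=; apply: out.
Qed.

Let left_probe d := probe (base d) (up d) (slope d - eta).
Let right_probe d := probe (base d) (up d) (slope d + eta).

Let slope_bounds d : d.1 \in E ->
  [/\ `|slope d| <= M, `|slope d - eta| <= M & `|slope d + eta| <= M].
Proof.
move=> /slope_lt le; split; first by apply: le_trans le; rewrite lerDl ltW.
  by apply: le_trans (ler_normB _ _) _; rewrite (gtr0_norm eta_gt0).
by apply: le_trans (ler_normD _ _) _; rewrite (gtr0_norm eta_gt0).
Qed.

Let around x : x - eta <= x + eta /\ x - eta < x < x + eta.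
Proof. by have eta0 := eta_gt0; split; [lra|apply/andP; split; lra]. Qed.

Let window d d' : d.1 \in E -> d'.1 \in E -> d' != d -> base d' = base d ->
  up d' = up d -> slope d - eta <= slope d' <= slope d + eta -> False.
Proof.
move=> dE d'E dd' bd ud /andP[l1 l2]; have := slope_gap d'E dE dd' bd ud.
by have eta0 := eta_gt0; case: ler0P => _; lra.
Qed.

(** By [slope_gap], all other darts, including the other dart of the same edge, stay off the segment
    between the two probes. *)
Let turn_across d q : d.1 \in E -> q \in E ->
  turn q (left_probe d) (right_probe d) = (q == d.1).
Proof.
move=> dE qE; have [_ lM rM] := slope_bounds dE.
have [le_lr in_lr] := around (slope d).
rewrite level_turn // -/(left_probe d) -/(right_probe d).
have other d' : d'.1 = q -> d' != d ->
    defect (ray d') (left_probe d) (right_probe d) = false.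
  move=> d'q d'd; apply: level_defect_ray => //; rewrite ?d'q //.
  by move=> bd ud; apply: window => //; rewrite d'q.
have self : defect (ray d) (left_probe d) (right_probe d) = true.
  exact: crossing_defect.
case: d dE lM rM le_lr in_lr other self => p s /= pE _ _ _ _ other self.
have [qp|qp] := eqVneq q p; last first.
  by rewrite !other //; apply: contra qp => /eqP[->].
subst q; have flip c : (p, ~~ c) != (p, c) by rewrite xpair_eqE eqxx; case: c.
case: s other self => other self; first by rewrite (other (p, false) erefl (flip true)).
by rewrite self (other (p, true) erefl (flip false)).
Qed.

Let face_across d C : d.1 \in E -> C \in cyclic_sets E ->
  (C \in face (left_probe d)) (+) (C \in face (right_probe d)) = (d.1 \in C).
Proof.
move=> dE CZ; rewrite [X in X (+) _]inE [X in _ (+) X]inE CZ /=.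
move: CZ; rewrite inE => /andP[/subsetP CE /eqP bC]; rewrite wind_turn //.
rewrite (eq_bigr (fun q => q == d.1)) => [|q qC]; last exact: turn_across (CE q qC).
have [dC|dC] := boolP (d.1 \in C).
  by rewrite (bigD1 d.1) //= eqxx big1 // => q /andP[_ /negPf].
by rewrite big1 // => q qC; apply: contraNF dC => /eqP <-.
Qed.

(** Telescoping along increasing slopes: [g] is constant between consecutive windows, so the jumps
    across the windows add up to the total change. *)
Let sweep (xs : seq R) (g : R -> bool) t0 :
  path (fun x y => x + eta <= y - eta) (t0 - eta) xs -> t0 <= M ->
  (forall x, x \in xs -> x + eta <= M) ->
  (forall t t', t0 <= t -> t <= t' -> t' <= M ->
    (forall x, x \in xs -> t <= x <= t' -> False) -> g t = g t') ->
  \big[addb/false]_(x <- xs) (g (x - eta) (+) g (x + eta)) = g t0 (+) g M.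
Proof.
have eta0 := eta_gt0; elim: xs t0 => [|x xs IH] t0 /=.
  by move=> _ t0M _ gE; rewrite big_nil (gE t0 M) ?addbb.
rewrite subrK => /andP[t0x sxs] t0M xsM gE.
have xM := xsM x (mem_head _ _).
have later y : y \in xs -> x + eta <= y - eta.
  have tr : transitive (fun x y : R => x + eta <= y - eta).
    by move=> b a c ab bc; lra.
  by move: sxs; rewrite (path_sortedE tr) => /andP[/allP + _]; apply.
rewrite big_cons (IH (x + eta)); first last.
- move=> t t' xt tt' t'M out; apply: gE => //; first by lra.
  move=> y; rewrite inE => /predU1P[->|/out//]; lra.
- by move=> y yxs; apply: xsM; rewrite inE yxs orbT.
- by [].
- by rewrite addrK.
rewrite (gE t0 (x - eta)) //; first by rewrite addbA; do 3!case: (g _).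
  by lra.
move=> y; rewrite inE => /predU1P[->|/later]; lra.
Qed.

Let sides_differ psi d :=
  (face (left_probe d) == psi) (+) (face (right_probe d) == psi).

Let rotation_level u s psi :
  \big[addb/false]_(d | [&& d.1 \in E, base d == u & up d == s]) sides_differ psi d =
  (face (probe u s (- M)) == psi) (+) (face (probe u s M) == psi).
Proof.
pose D := [pred d | [&& d.1 \in E, base d == u & up d == s]].
pose g t := face (probe u s t) == psi.
pose xs := sort <=%R [seq slope d | d <- enum D].
have xsP x : x \in xs -> exists2 d, D d & x = slope d.
  by rewrite mem_sort => /mapP[d]; rewrite mem_enum => Dd ->; exists d.
have gap d d' : D d -> D d' -> d != d' -> eta + eta < `|slope d - slope d'|.
  move=> /and3P[dE /eqP bd /eqP ud] /and3P[d'E /eqP bd' /eqP ud'] dd'.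
  by apply: slope_gap; rewrite ?bd ?bd' ?ud ?ud'.
have eta0 := eta_gt0; have M0 := M_ge0.
have u_xs : uniq xs.
  rewrite sort_uniq map_inj_in_uniq ?enum_uniq // => d d'.
  rewrite !mem_enum => Dd Dd' eq_s; apply/eqP; apply: contraT => dd'.
  by have := gap d d' Dd Dd' dd'; rewrite eq_s subrr normr0; lra.
pose r x y := x + eta <= y - eta.
have r_tr : transitive r by move=> b a c; rewrite /r; lra.
have sorted_xs : path r (- M - eta) xs.
  rewrite path_sortedE //; apply/andP; split.
    apply/allP => x /xsP[d /and3P[dE _ _] ->]; have [_ + _] := slope_bounds dE.
    by rewrite /r ler_norml; lra.
  have : sorted <%R xs by rewrite lt_sorted_uniq_le u_xs sort_sorted //; apply: le_total.
  apply: (@sub_in_sorted _ (mem xs)); last exact/allP.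
  move=> x y /xsP[d Dd ->] /xsP[d' Dd' ->] lt_dd'.
  have /(gap _ _ Dd Dd') : d != d' by apply: contraTneq lt_dd' => ->; rewrite ltxx.
  by rewrite ltr0_norm ?subr_lt0 // /r; lra.
transitivity (\big[addb/false]_(x <- xs) (g (x - eta) (+) g (x + eta))).
  rewrite (perm_big _ (permEl (perm_sort _ _))) big_map big_enum; apply: eq_bigr => d.
  case/and3P=> dE /eqP bd /eqP ud.
  by rewrite /sides_differ /left_probe /right_probe bd ud.
apply: sweep => //; first by lra.
  move=> x /xsP[d /and3P[dE _ _] ->]; have [_ _] := slope_bounds dE.
  by rewrite ler_norml => /andP[].
move=> t t' tM tt' t'M out; rewrite /g (@face_level u s t t') //.
- by rewrite ler_norml tM (le_trans tt').
- by rewrite ler_norml t'M andbT (le_trans tM).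
- move=> d dE bd ud; apply: out; rewrite mem_sort; apply: map_f.
  by rewrite mem_enum inE /= dE bd ud !eqxx.
Qed.

(** The vertical sides of the box meet no dart, slopes being smaller than [M] in absolute value. *)
Let face_vertical u t : `|t| = M -> face (probe u true t) = face (probe u false t).
Proof.
move=> tM; apply: face_eq => q qE.
have seg_box z : on_seg (probe u true t, probe u false t) z ->
    z.1 = (pos u).1 + rho * t /\ `|z.2 - (pos u).2| <= rho.
  move=> [l /andP[l0 l1] /= [-> ->]]; rewrite expr0 expr1; split; first by ring.
  have r0 := rho_gt0; rewrite ler_norml; apply/andP; split; nra.
have in_box z : on_seg (probe u true t, probe u false t) z -> box u z.
  case/seg_box => z1 z2; split=> //; rewrite z1 addrAC subrr add0r.
  by rewrite normrM tM gtr0_norm.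
rewrite /turn big1_seq => [|m /andP[_ mq]]; last first.
  by apply: defect_disjoint => z onm /in_box; move/(box_mids qE mq); apply.
have vert d : d.1 = q -> defect (ray d) (probe u true t) (probe u false t) = false.
  move=> dq; have dE : d.1 \in E by rewrite dq.
  apply: defect_disjoint => z on oz; have bd := box_rays dE (in_box z oz) on.
  have [+ _] := ray_shape dE on; have [-> z2] := seg_box z oz.
  rewrite bd addrAC subrr add0r => /(congr1 Num.norm).
  rewrite [`|rho * t|]normrM [`|slope d * _|]normrM normr_id tM gtr0_norm // => e.
  have := slope_lt dE; have := eta_gt0; have := rho_gt0 => r0 e0 sM.
  have : `|slope d| * `|z.2 - (pos u).2| <= `|slope d| * rho by rewrite ler_wpM2l.
  by rewrite -e [_ * rho]mulrC ler_pM2l // => Ms; lra.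
by rewrite !vert.
Qed.

(** Once around the box: the changes along the top and the bottom cancel, since the vertical sides
    change nothing. *)
Let rotation_dart u psi :
  \big[addb/false]_(d | (d.1 \in E) && (base d == u)) sides_differ psi d = false.
Proof.
rewrite (bigID up) /=.
have := rotation_level u true psi; have := rotation_level u false psi.
under eq_bigl do rewrite eqbF_neg andbA.
under [in X in _ -> X -> _]eq_bigl do rewrite eqb_id andbA.
move=> -> ->; rewrite !face_vertical ?normrN ?ger0_norm //.
by do 2!case: (_ == _).
Qed.

(** * Following an edge from one end to the other *)

Let transport p C z z' : p \in E -> C \in cyclic_sets E -> p \notin C ->
  (forall q, q \in E -> q != p -> turn q z z' = false) -> wind C z = wind C z'.
Proof.
rewrite inE => pE /andP[/subsetP CE /eqP bC] pC tq.
have := wind_turn z z' bC; rewrite big1 => [|q qC]; first by do 2!case: (wind _ _).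
by apply: tq (CE q qC) _; apply: contraNneq pC => <-.
Qed.

Let center d := probe (base d) (up d) (slope d).

Let turn_tip d q : d.1 \in E -> q \in E -> q != d.1 ->
  turn q (center d) (tip d) = false.
Proof.
move=> dE qE qd; have := tip_height dE; have := rho_lt dE; rewrite -subr_eq0.
set h := (tip d).2 - _ => rho_h h0.
have hN : `|h| != 0 by rewrite normr_eq0.
have sg : (-1) ^+ (~~ up d) * `|h| = h.
  rewrite /up -subr_gt0 -/h; case: ltgtP h0 => //= h0 _.
    by rewrite expr0 mul1r gtr0_norm.
  by rewrite expr1 mulN1r ltr0_norm // opprK.
have {}sg : (-1) ^+ (~~ up d) = h / `|h| by apply: (mulIf hN); rewrite sg divfK.
(* The parameter of [center d] on the dart. *)
pose l := rho / `|h|.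
have l01 : 0 < l < 1.
  by rewrite divr_gt0 ?normr_gt0 //= ltr_pdivrMr ?normr_gt0 // mul1r.
(* The segment to the tip stays on the dart and avoids its base, the only point where another edge
   may meet it. *)
have far z : on_seg (center d, tip d) z -> on_seg (ray d) z /\ z != pos (base d).
  move=> [m /andP[m0 m1] /= [z1 z2]]; move: l01 => /andP[l0 l1].
  have hE : (tip d).2 = (pos (base d)).2 + h by rewrite /h addrC subrK.
  have zE : z.2 = (pos (base d)).2 + (l + m * (1 - l)) * h.
    by rewrite z2 /center /probe /= sg hE /l; field.
  split; last first.
    apply: contraNneq h0 => zp; move: zE; rewrite zp => e.
    have : (l + m * (1 - l)) * h = 0 by lra.
    move/eqP; rewrite mulf_eq0 => /orP[/eqP e0|//]; exfalso; nra.
  exists (l + m * (1 - l)); first by apply/andP; split; nra.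
  split; rewrite /= ?zE ?hE; last by ring.
  by rewrite z1 /slope -/h /l; field.
have qd' : d.1 != q by rewrite eq_sym.
have ray0 d' : d'.1 = q -> defect (ray d') (center d) (tip d) = false.
  move=> d'q; apply: defect_disjoint => z on /far[on' /eqP]; apply.
  by apply: (rays_disjoint dE _ _ on' on).2; rewrite d'q.
rewrite /turn !ray0 // big1_seq // => m /andP[_ mq].
apply: defect_disjoint => z on /far[on' _].
exact: (ray_mids_disjoint dE qE qd' mq on' on).
Qed.

(** Move along the side of the box to the dart, then along the dart to its tip: only the edge [p] is
    touched, and it is not in [C]. *)
Let wind_tip p C c : p \in E -> C \in cyclic_sets E -> p \notin C ->
  wind C (left_probe (p, c)) = wind C (tip (p, c)).
Proof.
move=> pE CZ pC; pose d := (p, c); have dE : d.1 \in E by [].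
have [sM lM _] := slope_bounds dE; have [_ /andP[le1 le2]] := around (slope d).
rewrite (@transport p C (left_probe d) (center d)) //.
  by apply: (@transport p) => // q qE qp; apply: (@turn_tip d).
have {}le1 := ltW le1; move=> q qE qp; rewrite level_turn //.
have ray0 d' : d'.1 = q -> defect (ray d') (left_probe d) (center d) = false.
  move=> d'q; apply: level_defect_ray; rewrite ?d'q // => bd ud /andP[l1 l2].
  apply: (@window d d' dE _ _ bd ud); rewrite ?d'q //.
    by apply: contra qp => /eqP d'd; rewrite -d'q d'd.
  by rewrite l1 (le_trans l2) // ltW.
by rewrite !ray0.
Qed.

Let wind_mids p C : p \in E -> C \in cyclic_sets E -> p \notin C ->
  wind C (start p) = wind C (finish p).
Proof.
move=> pE CZ pC.
have : {in mids p, forall m, wind C m.1 = wind C m.2}.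
  move=> m mp; apply: (@transport p) => // q qE qp.
  have pq : p != q by rewrite eq_sym.
  have ray0 d' : d'.1 = q -> defect (ray d') m.1 m.2 = false.
    move=> d'q; apply: defect_disjoint; rewrite -surjective_pairing.
    by apply: ray_mids_disjoint mp; rewrite ?d'q.
  rewrite /turn !ray0 // big1_seq // => n /andP[_ nq].
  apply: defect_disjoint; rewrite -surjective_pairing.
  exact: mids_disjoint nq mp.
rewrite /mids /finish; elim: (mid p) (start p) => //= b l IH a h.
rewrite (h (a, b)) ?mem_head // IH // => m mm; apply: h.
by rewrite inE mm orbT.
Qed.

(* The two sides of an edge have the same pair of faces at both ends, although
   nothing is proved about which side at one end continues which at the other. *)
Let sides_differ_ends psi p : p \in E ->
  sides_differ psi (p, false) = sides_differ psi (p, true).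
Proof.
move=> pE; rewrite /sides_differ.
pose A c := face (left_probe (p, c)); pose B c := face (right_probe (p, c)).
rewrite -/(A false) -/(A true) -/(B false) -/(B true).
have AZ c C : C \in A c -> C \in cyclic_sets E by rewrite inE => /andP[].
have BZ c C : C \in B c -> C \in cyclic_sets E by rewrite inE => /andP[].
have memA c C : C \in cyclic_sets E -> (C \in A c) = wind C (left_probe (p, c)).
  by move=> CZ; rewrite inE CZ.
have across c C : C \in cyclic_sets E -> (C \in B c) = (C \in A c) (+) (p \in C).
  by move=> CZ; rewrite -(@face_across (p, c) C) // addbA addbb.
have memN C : C \in cyclic_sets E -> p \notin C -> (C \in A false) = (C \in A true).
  move=> CZ pC; rewrite !memA // !(wind_tip _ pE CZ pC); exact: wind_mids.
(* The left faces at the two ends agree on the sets avoiding [p]. If on the others they differ by a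
   constant [k], the pairs of faces coincide, with sides exchanged when [k] holds. *)
have same k : (forall C, C \in cyclic_sets E -> p \in C ->
    (C \in A false) = k (+) (C \in A true)) ->
    (if k then A false = B true /\ B false = A true
     else A false = A true /\ B false = B true).
  move=> AE; have ABE C : C \in cyclic_sets E ->
      (C \in A false) = (if k then C \in B true else C \in A true) /\
      (C \in B false) = (if k then C \in A true else C \in B true).
    move=> CZ; rewrite !across //; have [pC|pC] := boolP (p \in C).
      by rewrite AE //; case: k {AE} => /=; case: (C \in A true).
    by rewrite memN //; case: k {AE} => /=; rewrite !addbF.
  by case: k {AE} ABE => ABE; split; apply/setP => C;
    (have [CZ|CZ] := boolP (C \in cyclic_sets E); first by case: (ABE C CZ));
    rewrite !(contraNF (AZ _ C) CZ, contraNF (BZ _ C) CZ).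
have [C0 /andP[C0Z pC0]|none] := pickP (fun C => (C \in cyclic_sets E) && (p \in C)); last first.
  have [|-> ->//] := same false.
  by move=> C CZ pC; have := none C; rewrite CZ pC.
have := same ((C0 \in A false) (+) (C0 \in A true)).
(* The symmetric difference of two cyclic sets through [p] avoids [p], so [C0] determines [k] for
   all of them. *)
have CE C : C \in cyclic_sets E -> p \in C ->
    (C \in A false) = (C0 \in A false) (+) (C0 \in A true) (+) (C \in A true).
  move=> CZ pC; have SZ := cyclic_symdiff CZ C0Z.
  have := memN _ SZ; rewrite inE pC pC0 => /(_ isT).
  rewrite !memA // /wind !sum_symdiff.
  by do 4!case: (\big[_/_]_(_ in _) _).
move/(_ CE); case: ifP => _ [-> ->] //.
by rewrite addbC.
Qed.

Lemma polygonal_edge_bound (W : {set V}) (g : nat) :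
  (forall p, p \in E -> p.1 \in W /\ p.2 \in W) ->
  (forall C, C \in cyclic_sets E -> C != set0 -> (g <= #|C|)%N) ->
  (g * #|E| <= 2 * #|E| + g * #|W|)%N.
Proof.
move=> EW girthP.
apply: (@edge_bound V E W g (fun p => face (left_probe (p, false)))
  (fun p => face (right_probe (p, false)))) => //.
  by move=> C p CZ pE; apply: (@face_across (p, false)).
(* The sum over edges becomes a sum over darts, as both darts of an edge have the same value of
   [sides_differ]. *)
move=> u psi; rewrite -[RHS](rotation_dart u psi).
rewrite [RHS](eq_bigl (fun d => (d.1 \in E) && (base (d.1, d.2) == u))); last by case.
rewrite [RHS]big_mkcond -(pair_bigA _ (fun p c =>
  if (p \in E) && (base (p, c) == u) then sides_differ psi (p, c) else false)) /=.
rewrite [LHS]big_mkcond; apply: eq_bigr => p _; rewrite big_bool /=.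
case: ifP => //= pE; rewrite -(sides_differ_ends psi pE) /ends.
by rewrite -/(sides_differ psi (p, false)) /base /=; do 2!case: (_ == u);
  rewrite ?addbb ?addbF.
Qed.

End PolygonalDrawing.

From mathcomp Require Import all_classical all_reals all_analysis.
Import numFieldNormedType.Exports.

(** * From arcs to polygonal lines *)

Section PlaneTopology.
Local Open Scope classical_set_scope.
Local Open Scope ring_scope.
Variable R : realType.
Implicit Types (A B : set (R * R)) (x y z : R * R).

Lemma pair_norm x : `|x| = Num.max `|x.1| `|x.2|.
Proof. by []. Qed.

Let lerp_continuous (a b : R) : continuous (fun t : R => (1 - t) * a + t * b).
Proof.
move=> t.
apply: (@continuousD R R^o R^o (fun t => (1 - t) * a) (fun t => t * b)).
  apply: (@continuousM R R (fun t => 1 - t) (fun=> a)); last exact: cvg_cst.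
  by apply: (@continuousB R R^o R^o (fun=> 1) id); [exact: cvg_cst|exact: cvg_id].
by apply: (@continuousM R R id (fun=> b)); [exact: cvg_id|exact: cvg_cst].
Qed.

Lemma on_seg_compact sg : compact [set z | @on_seg R sg z].
Proof.
have -> : [set z | on_seg sg z] =
    (fun t : R => ((1 - t) * sg.1.1 + t * sg.2.1, (1 - t) * sg.1.2 + t * sg.2.2))
    @` `[0, 1].
  apply/seteqP; split=> z /=.
    by move=> [t t01 [z1 z2]]; exists t; rewrite ?in_itv //= -z1 -z2; case: z {z1 z2}.
  by move=> [t]; rewrite in_itv /= => t01 <-; exists t.
apply: continuous_compact; last exact: segment_compact.
apply: continuous_subspaceT => t.
have h := cvg_pair (@lerp_continuous sg.1.1 sg.2.1 t) (@lerp_continuous sg.1.2 sg.2.2 t).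
exact: h.
Qed.

(** The distances form a compact set, which is closed and misses zero. *)
Lemma compact_distance A B : compact A -> compact B ->
  (forall z, A z -> B z -> False) ->
  exists2 d : R, 0 < d & forall x y, A x -> B y -> d <= `|x - y|.
Proof.
move=> cA cB dis.
pose D := (fun xy : (R * R) * (R * R) => `|xy.1 - xy.2|) @` (A `*` B).
have cD : compact D.
  apply: continuous_compact; last exact: compact_setX.
  apply: continuous_subspaceT => xy; apply: cvg_norm.
  by apply: cvgB; [exact: cvg_fst|exact: cvg_snd].
have /closed_openC oD : closed D by apply: compact_closed => //; exact: Rhausdorff.
have : nbhs (0 : R) (~` D).
  apply: open_nbhs_nbhs; split=> // -[[x y] [/= Ax By] /eqP].
  by rewrite normr_eq0 subr_eq0 => /eqP xy; apply: (dis x) => //; rewrite xy.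
rewrite -nbhs_ballE => -[d /= d0 dD]; exists d => // x y Ax By.
rewrite leNgt; apply/negP => lt_d; apply: (dD `|x - y|).
  by rewrite /ball /= sub0r normrN normr_id.
by exists (x, y).
Qed.

(** The points reachable by such chains form a nonempty subset that is open and closed in [A]. *)
Lemma eps_chain A x y (eps : R) : connected A -> A x -> A y -> 0 < eps ->
  exists s, [/\ path (fun a b => `|a - b| < eps) x s, last x s = y &
                forall z, z \in s -> A z].
Proof.
move=> cA Ax Ay e0.
pose reach z := exists s, [/\ path (fun a b => `|a - b| < eps) x s, last x s = z &
                forall z, z \in s -> A z].
suff /seteqP[_ /(_ y Ay)[]] : [set z | A z /\ reach z] = A by [].
have near_reach z z' : reach z -> A z' -> `|z - z'| < eps -> reach z'.
  move=> [s [xs sz sA]] Az' zz'; exists (rcons s z'); split.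
  - by rewrite rcons_path xs sz.
  - by rewrite last_rcons.
  - by move=> w; rewrite mem_rcons inE => /predU1P[->//|/sA].
have ballP z z' : ball z eps z' -> `|z - z'| < eps by rewrite -ball_normE.
apply: cA.
- by exists x; split=> //; exists [::].
- exists (\bigcup_(z in [set z | A z /\ reach z]) ball z eps).
    by apply: bigcup_open => z _; exact: ball_open.
  apply/seteqP; split=> z.
    by move=> [Az rz]; split=> //; exists z => //; exact: ballxx.
  by move=> [Az [z' [Az' rz'] /ballP zz']]; split=> //; apply: near_reach rz' Az _.
- exists (~` \bigcup_(z in [set z | A z /\ ~ reach z]) ball z eps).
    by apply: open_closedC; apply: bigcup_open => z _; exact: ball_open.
  apply/seteqP; split=> z.
    move=> [Az rz]; split=> // -[z' [Az' nr] /ballP zz']; apply: nr.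
    by apply: near_reach rz Az' _; rewrite distrC.
  move=> [Az nb]; split=> //; apply: contrapT => nr; apply: nb.
  by exists z => //; exact: ballxx.
Qed.

Lemma within_eps (f : R -> R) (A : set R) t (eps : R) :
  {within A, continuous f} -> A t -> 0 < eps ->
  exists2 d, 0 < d & forall s, A s -> `|t - s| < d -> `|f t - f s| < eps.
Proof.
move=> /subspace_continuousP cf At e0.
have /cvgrPdist_lt/(_ eps e0) := cf t At.
by rewrite near_withinE => /nbhs_ballP[d /= d0 h]; exists d => // s As ts; apply: h.
Qed.

Lemma last_below (f : R -> R) (a b r : R) : a <= b -> {within `[a, b], continuous f} ->
  f a <= r -> r <= f b ->
  exists t, [/\ a <= t <= b, f t = r & forall s, t <= s <= b -> r <= f s].
Proof.
move=> ab cf far rfb.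
pose S := [set t | a <= t <= b /\ f t <= r].
have Sa : S a by split; rewrite ?lexx.
have supS : has_sup S by split; [exists a|exists b => t [/andP[]]].
pose t := sup S.
have tab : a <= t <= b.
  rewrite sup_upper_bound //=; apply: ge_sup; first by exists a.
  by move=> s [/andP[]].
have tin : [set` `[a, b]] t by rewrite /= in_itv.
have above s : t < s -> s <= b -> r < f s.
  move=> ts sb; rewrite ltNge; apply/negP => fsr; have [at_ _] := andP tab.
  have : s <= t; last by lra.
  by apply: sup_upper_bound => //; split=> //; rewrite sb andbT; lra.
have ft_le : f t <= r.
  rewrite leNgt; apply/negP => rft; have e0 : 0 < f t - r by rewrite subr_gt0.
  have [d d0 near_t] := within_eps cf tin e0.
  have [s Ss ts] := sup_adherent d0 supS; rewrite -/t in ts.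
  have st : s <= t by apply: sup_upper_bound.
  have [/andP[sa sb] fs] := Ss.
  have := near_t s; rewrite /= in_itv /= sa sb => /(_ isT).
  rewrite ger0_norm ?subr_ge0 // => h; have /h/ltr_normlW : t - s < d by lra.
  by lra.
have ft_ge : r <= f t.
  rewrite leNgt; apply/negP => ftr; have e0 : 0 < r - f t by rewrite subr_gt0.
  have [d d0 near_t] := within_eps cf tin e0.
  have [at_ tb] := andP tab; have {}tb : t < b.
    by rewrite lt_neqAle tb andbT; apply: contraTneq rfb => <-; rewrite -ltNge.
  pose s := Num.min (t + d / 2) b.
  have ts : t < s by rewrite lt_min tb andbT; lra.
  have sb : s <= b by rewrite ge_min lexx orbT.
  have sd : s <= t + d / 2 by rewrite ge_min lexx.
  have s_in : [set` `[a, b]] s by rewrite /= in_itv /= sb andbT; lra.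
  have st_lt : `|t - s| < d by rewrite distrC ger0_norm ?subr_ge0 ?(ltW ts) //; lra.
  have := near_t s s_in st_lt; rewrite distrC => /ltr_normlW.
  by have := above s ts sb; lra.
exists t; split=> //; first by apply/eqP; rewrite eq_le ft_le.
by move=> s /andP[]; rewrite le_eqVlt => /predU1P[<-//|ts /(above s ts)/ltW].
Qed.

Lemma first_below (f : R -> R) (a b r : R) : a <= b -> {within `[a, b], continuous f} ->
  r <= f a -> f b <= r ->
  exists t, [/\ a <= t <= b, f t = r & forall s, a <= s <= t -> r <= f s].
Proof.
move=> ab cf rfa fbr; pose h (s : R) := a + b - s.
have hE s : a <= s <= b -> a <= h s <= b by move=> /andP[? ?]; rewrite /h; lra.
have [|||t [tab ft tP]] := @last_below (f \o h) a b r ab.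
- apply/subspace_continuousP => s; rewrite /= in_itv /= => sab.
  apply/cvgrPdist_lt => e e0; rewrite near_withinE.
  have hin : [set` `[a, b]] (h s) by rewrite /= in_itv hE.
  have [d d0 near_s] := within_eps cf hin e0.
  apply/nbhs_ballP; exists d => //= s' ss' s'in; apply: near_s.
    by move: s'in; rewrite /= !in_itv /=; apply: hE.
  by rewrite (_ : h s - h s' = s' - s) 1?distrC // /h; ring.
- by rewrite /= /h addrAC subrr add0r.
- by rewrite /= /h addrK.
exists (h t); split=> //; first exact: hE.
move=> s /andP[as_ sht]; have := tP (h s); rewrite /= /h.
have -> : a + b - (a + b - s) = s by ring.
apply; move: sht tab; rewrite /h; lra.
Qed.

End PlaneTopology.

(** * Choice of the constants *)

Section SmallScale.
Local Open Scope ring_scope.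
Variable R : realType.

Lemma exists_small_seq (T : eqType) (s : seq T) (Q : T -> R -> Prop) :
  (forall i, i \in s -> exists2 d, 0 < d & forall x, 0 < x -> x <= d -> Q i x) ->
  exists2 d, 0 < d & forall i x, i \in s -> 0 < x -> x <= d -> Q i x.
Proof.
elim: s => [|i s IH] h; first by exists 1.
have [j js|d d0 hd] := IH; first by apply: h; rewrite inE js orbT.
have [d' d'0 hd'] := h i (mem_head _ _).
exists (Num.min d d') => [|j x]; first by rewrite lt_min d0.
rewrite inE le_min => /predU1P[->|js] x0 /andP[xd xd']; first exact: hd'.
exact: hd.
Qed.

Lemma exists_small (I : finType) (Q : I -> R -> Prop) :
  (forall i, exists2 d, 0 < d & forall x, 0 < x -> x <= d -> Q i x) ->
  exists2 d, 0 < d & forall i x, 0 < x -> x <= d -> Q i x.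
Proof.
move=> h; have [i _|d d0 hd] := @exists_small_seq I (enum I) Q; first exact: h.
by exists d => // i x; apply: hd; rewrite mem_enum.
Qed.

Lemma off_segment_box sg (w : R * R) : ~ on_seg sg w ->
  exists2 d, 0 < d & forall x, 0 < x -> x <= d -> forall z,
    `|z.1 - w.1| <= x -> `|z.2 - w.2| <= x -> ~ on_seg sg z.
Proof.
move=> off; have [|d d0 dP] := @compact_distance R _ _ (@compact_set1 _ w) (@on_seg_compact R sg).
  by move=> z ->.
exists (d / 2); first by lra.
move=> x x0 xd z z1 z2 /(dP w z erefl).
rewrite leNgt => /negP; apply; rewrite distrC pair_norm gt_max /=.
by apply/andP; split; lra.
Qed.

Variables (V : finType) (E : {set V * V}).
Implicit Types (p q : V * V) (u v : V) (d : (V * V) * bool).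

(** Distinct edges meet only at a common end. The line of one edge may cross itself, as the chains
    of [eps_chain] can. *)
Record polygonal_drawing (pos : V -> R * R) (start : V * V -> R * R)
    (mid : V * V -> seq (R * R)) : Prop := PolygonalDrawing {
  tip_pos : forall d, d.1 \in E -> tip start mid d != pos (base d);
  ray_pos : forall d u, d.1 \in E -> on_seg (ray pos start mid d) (pos u) -> u = base d;
  mid_pos : forall p m u, p \in E -> m \in mids start mid p -> ~ on_seg m (pos u);
  mid_mid : forall p q m n, p \in E -> q \in E -> p != q ->
    m \in mids start mid p -> n \in mids start mid q -> disjoint_segs m n;
  ray_mid : forall d q m, d.1 \in E -> q \in E -> d.1 != q ->
    m \in mids start mid q -> disjoint_segs (ray pos start mid d) m;
  ray_ray : forall d d' z, d.1 \in E -> d'.1 \in E -> d.1 != d'.1 ->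
    on_seg (ray pos start mid d) z -> on_seg (ray pos start mid d') z ->
    base d = base d' /\ z = pos (base d) }.

Variables (W : {set V}) (g : nat).
Hypothesis loopless : forall p, p \in E -> p.1 != p.2.
Hypothesis EW : forall p, p \in E -> p.1 \in W /\ p.2 \in W.
Hypothesis girthP : forall C, C \in cyclic_sets E -> C != finset.set0 -> (g <= #|C|)%N.

(** It remains to choose [eta], then [M], then [rho], each subject to finitely many conditions. *)
Lemma nonhorizontal_edge_bound pos start mid :
  polygonal_drawing pos start mid ->
  (forall d, d.1 \in E -> (tip start mid d).2 != (pos (base d)).2) ->
  (g * #|E| <= 2 * #|E| + g * #|W|)%N.
Proof.
move=> D th.
pose slope d := ((tip start mid d).1 - (pos (base d)).1) /
  `|(tip start mid d).2 - (pos (base d)).2|.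
pose up d := (pos (base d)).2 < (tip start mid d).2.
have slope_neq d d' : d.1 \in E -> d'.1 \in E -> d != d' -> base d = base d' ->
    up d = up d' -> slope d != slope d'.
  move=> dE d'E dd' bd ud; apply/negP => /eqP sd.
  have dd1 : d.1 != d'.1.
    apply: contra dd' => /eqP d1; case: d d' d1 bd {dE ud sd} d'E => p c [p' c'] /= <-.
    have [-> //|cc'] := eqVneq c c'; rewrite /base /= => b /loopless.
    by case: c c' cc' b => -[] //= _ ->; rewrite eqxx.
  pose h d := `|(tip start mid d).2 - (pos (base d)).2|.
  have h0 d1 : d1.1 \in E -> 0 < h d1 by move=> /th; rewrite normr_gt0 subr_eq0.
  have hd0 := h0 d dE; have hd'0 := h0 d' d'E.
  (* Two darts of equal base, direction and slope overlap: at the smaller of their heights they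
     share the point [z], which is not the base. *)
  pose k := Num.min (h d) (h d').
  have k0 : 0 < k by rewrite lt_min hd0.
  have kh : k <= h d by rewrite ge_min lexx.
  have kh' : k <= h d' by rewrite ge_min lexx orbT.
  pose z := ((pos (base d)).1 + slope d * k, (pos (base d)).2 + (-1) ^+ (~~ up d) * k).
  have on d1 : d1.1 \in E -> base d1 = base d -> up d1 = up d -> slope d1 = slope d ->
      k <= h d1 -> on_seg (ray pos start mid d1) z.
    move=> d1E b1 u1 s1 kh1; have hd1 := h0 d1 d1E.
    have hN : h d1 != 0 by rewrite gt_eqF.
    have t2 : (tip start mid d1).2 = (pos (base d)).2 + (-1) ^+ (~~ up d) * h d1.
      rewrite -u1 -b1 /up /h -subr_gt0; move: (th d1 d1E); rewrite -subr_eq0.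
      by case: ltgtP => //= t0 _; rewrite ?(gtr0_norm t0) ?(ltr0_norm t0) ?expr0 ?expr1; lra.
    have t1 : (tip start mid d1).1 = (pos (base d)).1 + slope d * h d1.
      by rewrite -s1 -b1 /slope -/(h d1) divfK // addrC subrK.
    exists (k / h d1).
      by rewrite divr_ge0 ?(ltW k0) ?(ltW hd1) //= ler_pdivrMr // mul1r.
    by rewrite /= b1 t1 t2; split; field.
  have [_ /(congr1 snd) /=] :=
    ray_ray D dE d'E dd1 (on d dE erefl erefl erefl kh)
      (on d' d'E (esym bd) (esym ud) (esym sd) kh').
  rewrite -[in RHS](addr0 (pos _).2) => /addrI/eqP.
  by rewrite mulf_eq0 signr_eq0 (gt_eqF k0).
have [eta eta0 etaP] : exists2 eta : R, 0 < eta & forall dd x, 0 < x -> x <= eta ->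
    dd.1.1 \in E -> dd.2.1 \in E -> dd.1 != dd.2 -> base dd.1 = base dd.2 ->
    up dd.1 = up dd.2 -> x + x < `|slope dd.1 - slope dd.2|.
  apply: (@exists_small _ (fun dd x => _)) => -[d d'] /=.
  have [sd|sd] := eqVneq (slope d) (slope d').
    by exists 1 => // x _ _ dE d'E dd' bd ud; have := slope_neq d d' dE d'E dd' bd ud;
      rewrite sd eqxx.
  have s0 : 0 < `|slope d - slope d'| by rewrite normr_gt0 subr_eq0.
  by exists (`|slope d - slope d'| / 3) => [|x x0 xd _ _ _ _ _]; lra.
pose M := eta + \sum_d `|slope d|.
have sum_ge d : `|slope d| <= \sum_d `|slope d|.
  by rewrite (bigD1 d) //= lerDl sumr_ge0.
have M0 : 0 <= M by rewrite addr_ge0 ?(ltW eta0) // sumr_ge0.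
have [d1 d10 d1P] : exists2 x0 : R, 0 < x0 & forall ud x, 0 < x -> x <= x0 ->
    ud.2.1 \in E -> ud.1 != base ud.2 -> forall z,
    `|z.1 - (pos ud.1).1| <= x -> `|z.2 - (pos ud.1).2| <= x ->
    ~ on_seg (ray pos start mid ud.2) z.
  apply: (@exists_small _ (fun ud x => _)) => -[u d] /=.
  have [dE|dE] := boolP (d.1 \in E); last by exists 1.
  have [ud|ud] := eqVneq u (base d); first by exists 1.
  have [|x0 x00 x0P] := @off_segment_box (ray pos start mid d) (pos u).
    by move/(ray_pos D dE)/eqP; apply/negP.
  by exists x0 => // x x1 x2 _ _; apply: x0P.
have [d2 d20 d2P] : exists2 x0 : R, 0 < x0 & forall up x, 0 < x -> x <= x0 ->
    up.2 \in E -> forall m, m \in mids start mid up.2 -> forall z,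
    `|z.1 - (pos up.1).1| <= x -> `|z.2 - (pos up.1).2| <= x -> ~ on_seg m z.
  apply: (@exists_small _ (fun up x => _)) => -[u p] /=.
  have [pE|pE] := boolP (p \in E); last by exists 1.
  have [|x0 x00 x0P] := @exists_small_seq _ (mids start mid p) (fun m x => forall z,
    `|z.1 - (pos u).1| <= x -> `|z.2 - (pos u).2| <= x -> ~ on_seg m z).
    by move=> m mp; apply: off_segment_box => on; apply: (mid_pos D pE mp on).
  by exists x0 => // x x1 x2 _ m mp; apply: x0P.
have [d3 d30 d3P] : exists2 x0 : R, 0 < x0 & forall d x, 0 < x -> x <= x0 ->
    d.1 \in E -> x < `|(tip start mid d).2 - (pos (base d)).2|.
  apply: (@exists_small _ (fun d x => _)) => d /=.
  have [dE|dE] := boolP (d.1 \in E); last by exists 1.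
  have h0 : 0 < `|(tip start mid d).2 - (pos (base d)).2|.
    by rewrite normr_gt0 subr_eq0 th.
  by exists (`|(tip start mid d).2 - (pos (base d)).2| / 2) => [|x x0 xd _]; lra.
pose x0 := Num.min d1 (Num.min d2 d3).
have x00 : 0 < x0 by rewrite !lt_min d10 d20.
have [xd1 xd2 xd3] : [/\ x0 <= d1, x0 <= d2 & x0 <= d3].
  by rewrite !ge_min !lexx !orbT.
have M1 : 0 < M + 1 by lra.
(* This makes both [rho] and [rho * M] at most [x0]. *)
pose rho := x0 / (M + 1).
have rho0 : 0 < rho by rewrite divr_gt0.
have rho_x : rho <= x0 by rewrite ler_pdivrMr // ler_peMr ?(ltW x00) //; lra.
have rhoM_x : rho * M <= x0.
  by rewrite /rho mulrAC ler_pdivrMr // ler_wpM2l ?(ltW x00) //; lra.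
apply: (@polygonal_edge_bound R V E pos start mid th _ _ _ rho eta M) => //.
- exact: (mid_mid D).
- exact: (ray_mid D).
- exact: (ray_ray D).
- by move=> d dE; rewrite addrC lerD2l.
- by move=> d; apply: d3P => //; lra.
- move=> u p m z pE mp [z1 z2]; apply: (d2P (u, p) x0 x00 xd2 pE m mp) => /=; lra.
- move=> u d z dE [z1 z2] on; apply/esym/eqP; apply: contraT => ud.
  by case: (d1P (u, d) x0 x00 xd1 dE ud z) => //=; lra.
- by move=> d d' dE d'E dd' bd ud; apply: (etaP (d, d') eta).
Qed.

(* A shear makes all the darts nonhorizontal. *)
Definition shear (k : R) (z : R * R) : R * R := (z.1, z.2 + k * z.1).

Lemma shearK k : cancel (shear k) (shear (- k)).
Proof. by case=> x y; rewrite /shear /= mulNr addrK. Qed.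

Lemma on_seg_shear k sg z :
  on_seg (shear k sg.1, shear k sg.2) z <-> on_seg sg (shear (- k) z).
Proof.
split=> -[t t01 [/= z1 z2]]; exists t => //; split=> //=.
- by rewrite z1 z2; ring.
- by rewrite -(addrNK (k * z.1) z.2) -mulNr z2 z1; ring.
Qed.

Lemma polygonal_drawing_edge_bound pos start mid :
  polygonal_drawing pos start mid -> (g * #|E| <= 2 * #|E| + g * #|W|)%N.
Proof.
move=> D.
(* At most one positive factor makes a given dart horizontal, so all small ones are good. *)
have [k k0 kP] : exists2 k : R, 0 < k & forall d x, 0 < x -> x <= k -> d.1 \in E ->
    (shear x (tip start mid d)).2 != (shear x (pos (base d))).2.
  apply: (@exists_small _ (fun d x => _)) => d.
  have [dE|dE] := boolP (d.1 \in E); last by exists 1.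
  have := tip_pos D dE; rewrite /shear /=.
  move: (tip _ _ _) (pos _) => [a1 a2] [b1 b2] /= ab.
  have [h0|h0] := eqVneq (a2 - b2) 0.
    exists 1 => // x x0 _ _; apply: contra ab => /eqP e.
    have a2b2 : a2 = b2 by lra.
    have /eqP : x * (a1 - b1) = 0 by rewrite a2b2 in e; lra.
    by rewrite mulf_eq0 gt_eqF //= subr_eq0 a2b2 => /eqP ->.
  have N0 : 0 < `|a1 - b1| + 1 by rewrite ltr_wpDl.
  exists (`|a2 - b2| / (`|a1 - b1| + 1) / 2) => [|x x0 xk _].
    by rewrite !divr_gt0 ?normr_gt0.
  apply/eqP => e; have {}e : a2 - b2 = - (x * (a1 - b1)) by lra.
  have : `|a2 - b2| = x * `|a1 - b1| by rewrite e normrN normrM gtr0_norm.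
  move: xk; rewrite -mulrA -invfM ler_pdivlMr ?mulr_gt0 //; nra.
pose pos' u := shear k (pos u); pose start' p := shear k (start p).
pose mid' p := map (shear k) (mid p).
have tipE d : tip start' mid' d = shear k (tip start mid d).
  by rewrite /tip; case: ifP => // _; apply: last_map.
have rayE d z : on_seg (ray pos' start' mid' d) z <-> on_seg (ray pos start mid d) (shear (- k) z).
  by rewrite /ray tipE; apply: (on_seg_shear k (pos (base d), tip start mid d)).
have midsE p : mids start' mid' p = [seq (shear k m.1, shear k m.2) | m <- mids start mid p].
  by rewrite /mids /mid' /start'; elim: (mid p) (start p) => //= b l IH a; rewrite IH.
apply: (@nonhorizontal_edge_bound pos' start' mid'); last first.
  by move=> d dE; rewrite tipE; apply: kP.
split=> [d dE|d u dE|p m u pE|p q m n pE qE pq|d q m dE qE dq|d d' z dE d'E dd'].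
- by rewrite tipE (can_eq (shearK k)); apply: tip_pos D _ dE.
- by move=> /rayE; rewrite shearK; apply: ray_pos D _ _ dE.
- rewrite midsE => /mapP[m0 mp ->] /on_seg_shear; rewrite shearK.
  exact: (mid_pos D pE mp).
- rewrite !midsE => /mapP[m0 mp ->] /mapP[n0 nq ->] z /on_seg_shear mz /on_seg_shear.
  exact: (mid_mid D pE qE pq mp nq mz).
- rewrite midsE => /mapP[m0 mp ->] z /rayE dz /on_seg_shear.
  exact: (ray_mid D dE qE dq mp dz).
- move=> /rayE dz /rayE d'z; have [-> zE] := ray_ray D dE d'E dd' dz d'z.
  split=> //; rewrite /pos' -zE.
  by rewrite -{1}(opprK k) shearK.
Qed.

End SmallScale.

(** * Approximation of the arcs *)

Section Polygonalization.
Local Open Scope classical_set_scope.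
Local Open Scope ring_scope.
Variable R : realType.
Implicit Types (P Q z : R * R) (K : set (R * R)).

Lemma dist_continuous (f : R -> R * R) (A : set R) P :
  {within A, continuous f} -> {within A, continuous (fun t => `|f t - P|)}.
Proof.
move=> cf t; apply: cvg_norm; apply: cvgB; [exact: cf|exact: cvg_cst].
Qed.

(* [K] is the part of the arc between its last exit from the ball around [f 0]
   and the first subsequent entry into the ball around [f 1]. *)
Lemma trim_arc (f : R -> R * R) (r : R) : {within `[0, 1], continuous f} ->
  0 < r -> r + r <= `|f 0 - f 1| ->
  exists K a b, [/\ compact K, connected K, K a, K b &
    [/\ K `<=` f @` `[0, 1], `|a - f 0| = r, `|b - f 1| = r &
        forall z, K z -> r <= `|z - f 0| /\ r <= `|z - f 1|]].
Proof.
move=> cf r0 r2.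
have [|||t0 [t01 /= ft0 t0P]] := @last_below _ (fun t => `|f t - f 0|) 0 1 r ler01.
- exact: dist_continuous.
- by rewrite subrr normr0 ltW.
- by rewrite distrC; lra.
have [t0_ge0 t0_le1] := andP t01.
have sub01 : `[t0, 1] `<=` `[0, 1].
  by move=> s /=; rewrite !in_itv /= => /andP[s0 s1]; lra.
have cf1 : {within `[t0, 1], continuous (fun t => `|f t - f 1|)}.
  by apply: continuous_subspaceW sub01 _; exact: dist_continuous.
have [||t1 [t11 /= ft1 t1P]] := @first_below _ (fun t => `|f t - f 1|) t0 1 r t0_le1 cf1.
- have := ler_distD (f t0) (f 0) (f 1); rewrite (distrC (f 0) (f t0)) ft0; lra.
- by rewrite subrr normr0 ltW.
have [t1_ge t1_le] := andP t11.
have sub : `[t0, t1] `<=` `[0, 1].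
  by move=> s /=; rewrite !in_itv /= => /andP[s0 s1]; lra.
have cf' : {within `[t0, t1], continuous f} by apply: continuous_subspaceW sub cf.
exists (f @` `[t0, t1]), (f t0), (f t1); split.
- by apply: continuous_compact => //; exact: segment_compact.
- by apply: connected_continuous_connected => //; exact: segment_connected.
- by exists t0; rewrite //= in_itv /= lexx.
- by exists t1; rewrite //= in_itv /= lexx andbT.
- split=> //; first exact: image_subset.
  move=> _ [s /= + <-]; rewrite in_itv /= => /andP[s0 s1]; split.
    by apply: t0P; rewrite s0 (le_trans s1).
  by apply: t1P; rewrite s0.
Qed.

Lemma on_seg_dist sg z : on_seg sg z ->
  exists2 t : R, 0 <= t <= 1 & z - sg.1 = t *: (sg.2 - sg.1).
Proof.
move=> [t t01 [z1 z2]]; exists t => //; apply/eqP; rewrite -pair_eqE /=.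
by rewrite z1 z2; apply/andP; split; apply/eqP; rewrite /GRing.scale /=; ring.
Qed.

Lemma on_seg_near sg z (eps : R) : on_seg sg z -> `|sg.1 - sg.2| < eps -> `|z - sg.1| < eps.
Proof.
move=> /on_seg_dist[t /andP[t0 t1] ->]; rewrite normrZ ger0_norm // distrC.
by apply: le_lt_trans; rewrite ler_piMl.
Qed.

Variables (V : finType) (e : rel V) (E : {set V * V}).
Implicit Types (p q : V * V) (u v : V) (d : (V * V) * bool).
Hypothesis E_sub : forall p, p \in E -> e p.1 p.2.
Hypothesis oriented : forall u v, (u, v) \in E -> (v, u) \notin E.
Hypothesis loopless : forall p, p \in E -> p.1 != p.2.

(** Take balls of radius [s] around the vertices, so small that they are disjoint and met only by
    incident arcs. Outside them, the arcs contain disjoint compact connected sets [K p], which are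
    replaced by fine chains; inside, straight segments join the vertices to the ends of the
    [K p]. *)
Lemma planar_polygonal_drawing : planar R e ->
  exists (pos : V -> R * R) start mid, polygonal_drawing E pos start mid.
Proof.
move=> [pos [arc [pos_inj arcP arc_pos arc_arc]]]; exists pos.
have /choice[f fP] p : exists f : R -> R * R, p \in E ->
    [/\ {within `[0, 1], continuous f}, f 0 = pos p.1, f 1 = pos p.2 &
        arc p.1 p.2 = f @` `[0, 1]].
  have [pE|pE] := boolP (p \in E); last by exists (fun=> 0).
  by have [[f [cf _ f0 f1 fA]] _] := arcP _ _ (E_sub pE); exists f.
have arcs_meet p q z : p \in E -> q \in E -> p != q ->
    arc p.1 p.2 z -> arc q.1 q.2 z -> exists w, z = pos w.
  move=> pE qE pq pz qz.
  have [||w ->] := arc_arc _ _ _ _ (E_sub pE) (E_sub qE) _ _ z pz qz; last by exists w.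
    by rewrite -!surjective_pairing eq_sym.
  apply/eqP => qp; move: pE qE (oriented (u := p.1) (v := p.2)).
  by rewrite -!surjective_pairing => pE qE /(_ pE); rewrite -qp -surjective_pairing qE.
have [r r0 rP] : exists2 r : R, 0 < r & forall uv x, 0 < x -> x <= r ->
    uv.1 != uv.2 -> x + x < `|pos uv.1 - pos uv.2|.
  apply: (@exists_small R (V * V)%type (fun uv x => _)) => -[u v] /=.
  have [uv|uv] := eqVneq u v; first by exists 1.
  have d0 : 0 < `|pos u - pos v| by rewrite normr_gt0 subr_eq0 (inj_eq pos_inj).
  by exists (`|pos u - pos v| / 3) => [|x x0 xd _]; lra.
have [r' r'0 r'P] : exists2 r : R, 0 < r & forall up x, 0 < x -> x <= r ->
    up.2 \in E -> up.1 != up.2.1 -> up.1 != up.2.2 ->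
    forall z, arc up.2.1 up.2.2 z -> x <= `|z - pos up.1|.
  apply: (@exists_small R (V * (V * V))%type (fun up x => _)) => -[u p] /=.
  have [pE|pE] := boolP (p \in E); last by exists 1.
  have [u1|u1] := eqVneq u p.1; first by exists 1.
  have [u2|u2] := eqVneq u p.2; first by exists 1.
  have [cf _ _ fA] := fP p pE.
  have cA : compact (arc p.1 p.2).
    by rewrite fA; apply: continuous_compact => //; exact: segment_compact.
  have [|x x0 xP] := compact_distance cA (@compact_set1 _ (pos u)).
    move=> z pz zu; move: pz; rewrite zu => /(arc_pos _ _ _ (E_sub pE)).
    by case=> uE; [rewrite uE eqxx in u1|rewrite uE eqxx in u2].
  by exists x => // y _ yx _ _ _ z pz; apply: le_trans yx (xP _ _ pz _).
have [s s0 [sr sr']] : exists2 s, 0 < s & s <= r /\ s <= r'.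
  by exists (Num.min r r'); rewrite ?lt_min ?r0 // !ge_min !lexx orbT.
have pos_far u v : u != v -> s + s < `|pos u - pos v|.
  by move=> uv; apply: (rP (u, v)).
have /choice[T TP] p : exists T : set (R * R) * ((R * R) * (R * R)), p \in E ->
    [/\ compact T.1, connected T.1, T.1 T.2.1, T.1 T.2.2 &
    [/\ T.1 `<=` arc p.1 p.2, `|T.2.1 - pos p.1| = s, `|T.2.2 - pos p.2| = s &
        forall z w, T.1 z -> s <= `|z - pos w|]].
  have [pE|pE] := boolP (p \in E); last by exists (set0, (0, 0)).
  have [cf f0 f1 fA] := fP p pE.
  have [|K [a [b [cK conK Ka Kb [KA aP bP KP]]]]] := trim_arc cf s0.
    by rewrite f0 f1 ltW // pos_far // loopless.
  exists (K, (a, b)) => _; split=> //=; rewrite -f0 -f1 fA; split=> // z w Kz.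
  have [->|w1] := eqVneq w p.1; first by rewrite -f0; case: (KP z Kz).
  have [->|w2] := eqVneq w p.2; first by rewrite -f1; case: (KP z Kz).
  by apply: (r'P (w, p)) => //=; rewrite fA; apply: KA.
pose K p := (T p).1; pose start p := (T p).2.1; pose fin p := (T p).2.2.
pose tip0 d := if d.2 then fin d.1 else start d.1.
pose ray0 d := (pos (base d), tip0 d).
have K_arc p z : p \in E -> K p z -> arc p.1 p.2 z.
  by move=> pE; have [_ _ _ _ [+ _ _ _]] := TP p pE; apply.
have K_far p z w : p \in E -> K p z -> s <= `|z - pos w|.
  by move=> pE; have [_ _ _ _ [_ _ _ +]] := TP p pE; apply.
have K_tip d : d.1 \in E -> K d.1 (tip0 d).
  by move=> dE; have [_ _ Ka Kb _] := TP d.1 dE; rewrite /tip0; case: ifP.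
have tip_dist d : d.1 \in E -> `|tip0 d - pos (base d)| = s.
  move=> dE; have [_ _ _ _ [_ aP bP _]] := TP d.1 dE.
  by rewrite /tip0 /base; case: ifP.
have K_disjoint p q z : p \in E -> q \in E -> p != q -> K p z -> K q z -> False.
  move=> pE qE pq Kp Kq; have [w zw] := arcs_meet p q z pE qE pq (K_arc _ _ pE Kp) (K_arc _ _ qE Kq).
  by have := K_far p z w pE Kp; rewrite zw subrr normr0 leNgt s0.
have ray_near d z : d.1 \in E -> on_seg (ray0 d) z ->
    exists2 t : R, 0 <= t <= 1 & z - pos (base d) = t *: (tip0 d - pos (base d)) /\
      `|z - pos (base d)| = t * s.
  move=> dE /on_seg_dist[t /andP[t0 t1] zE]; exists t; first by rewrite t0.
  by rewrite [LHS]/= zE normrZ ger0_norm // tip_dist.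
have ray_le d z : d.1 \in E -> on_seg (ray0 d) z -> `|z - pos (base d)| <= s.
  by move=> dE /(ray_near d z dE)[t /andP[t0 t1] [_ ->]]; rewrite ler_piMl // ltW.
(* The ray stays in the ball of radius [s] and [K q] outside it, so they could only meet at the tip,
   which belongs to [K d.1]. *)
have ray_K d q z : d.1 \in E -> q \in E -> d.1 != q -> on_seg (ray0 d) z -> K q z -> False.
  move=> dE qE dq dz Kz; have sz := K_far q z (base d) qE Kz.
  have [t /andP[t0 t1] [zE zs]] := ray_near d z dE dz.
  have /eqP t1E : t == 1.
    by rewrite eq_le t1 -(ler_pM2r s0) mul1r -zs.
  move: zE; rewrite t1E scale1r => /addIr zE.
  by apply: (K_disjoint d.1 q z) => //; rewrite zE; apply: K_tip.
have K_dist p q : p \in E -> q \in E -> p != q ->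
    exists2 x : R, 0 < x & forall z z', K p z -> K q z' -> x <= `|z - z'|.
  move=> pE qE pq; have [cp _ _ _ _] := TP p pE; have [cq _ _ _ _] := TP q qE.
  by apply: compact_distance => // z; apply: K_disjoint.
have [e1 e10 e1P] : exists2 x0 : R, 0 < x0 & forall pq x, 0 < x -> x <= x0 ->
    pq.1 \in E -> pq.2 \in E -> pq.1 != pq.2 ->
    forall z z', K pq.1 z -> K pq.2 z' -> x <= `|z - z'|.
  apply: (@exists_small R ((V * V) * (V * V))%type (fun pq x => _)) => -[p q] /=.
  have [/and3P[pE qE pq]|n] := boolP [&& p \in E, q \in E & p != q].
    have [x x0 xP] := K_dist p q pE qE pq.
    by exists x => // y _ yx _ _ _ z z' pz qz; apply: le_trans yx (xP _ _ pz qz).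
  by exists 1 => // y _ _ pE qE pq; rewrite pE qE pq in n.
have [e2 e20 e2P] : exists2 x0 : R, 0 < x0 & forall dq x, 0 < x -> x <= x0 ->
    dq.1.1 \in E -> dq.2 \in E -> dq.1.1 != dq.2 ->
    forall z z', on_seg (ray0 dq.1) z -> K dq.2 z' -> x <= `|z - z'|.
  apply: (@exists_small R (((V * V) * bool) * (V * V))%type (fun dq x => _)) => -[d q] /=.
  have [/and3P[dE qE dq]|n] := boolP [&& d.1 \in E, q \in E & d.1 != q].
    have [cq _ _ _ _] := TP q qE.
    have [z dz qz|x x0 xP] := compact_distance (@on_seg_compact R (ray0 d)) cq.
      exact: (ray_K d q z).
    by exists x => // y _ yx _ _ _ z z' pz qz; apply: le_trans yx (xP _ _ pz qz).
  by exists 1 => // y _ _ dE qE dq; rewrite dE qE dq in n.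
(* Points of a chain segment are within [eps] of [K]; half of the minimum keeps them off the other
   chains, the rays of other edges and the vertices. *)
pose eps := Num.min s (Num.min e1 e2) / 2.
have eps0 : 0 < eps by rewrite divr_gt0 // !lt_min s0 e10.
have [eps_s eps_1 eps_2] : [/\ eps + eps <= s, eps + eps <= e1 & eps + eps <= e2].
  by rewrite /eps -splitr !ge_min !lexx !orbT.
have /choice[mid midP] p : exists l, p \in E ->
    [/\ path (fun a b => `|a - b| < eps) (start p) l, last (start p) l = fin p &
        forall z, z \in l -> K p z].
  have [pE|pE] := boolP (p \in E); last by exists [::].
  have [_ conK Ka Kb _] := TP p pE.
  by have [l lP] := eps_chain conK Ka Kb eps0; exists l.
exists start, mid.
have tipE d : d.1 \in E -> tip start mid d = tip0 d.
  by move=> dE; rewrite /tip /tip0 /finish; have [_ -> _] := midP d.1 dE.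
have rayE d : d.1 \in E -> ray pos start mid d = ray0 d.
  by move=> dE; rewrite /ray tipE.
have midsP p m : p \in E -> m \in mids start mid p -> K p m.1 /\ `|m.1 - m.2| < eps.
  move=> pE; have [+ _ +] := midP p pE; have [_ _ + _ _] := TP p pE.
  rewrite /mids -/(start p) -/(K p); elim: (mid p) (start p) => //= b l IH a Ka.
  move=> /andP[ab bl] lK; rewrite inE => /predU1P[->//|]; apply: IH => //.
    by apply: lK; rewrite inE eqxx.
  by move=> z zl; apply: lK; rewrite inE zl orbT.
have mids_near p m z : p \in E -> m \in mids start mid p -> on_seg m z ->
    K p m.1 /\ `|z - m.1| < eps.
  by move=> pE /(midsP p m pE)[Km m12] mz; split=> //; apply: on_seg_near.
split=> [d dE|d u dE|p m u pE mp mu|p q m n pE qE pq mp nq z mz nz|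
         d q m dE qE dq mq z|d d' z dE d'E dd'].
- by rewrite tipE // -subr_eq0 -normr_gt0 tip_dist.
- rewrite rayE // => /(ray_le d _ dE) le_s; apply/eqP; apply: contraLR isT => ub.
  by have := pos_far _ _ ub; lra.
- have [Km lt_eps] := mids_near p m _ pE mp mu.
  by have := K_far p m.1 u pE Km; rewrite distrC; lra.
- have [Km lt_m] := mids_near p m z pE mp mz; have [Kn lt_n] := mids_near q n z qE nq nz.
  have := e1P (p, q) e1 e10 (lexx _) pE qE pq m.1 n.1 Km Kn.
  have := ler_distD z m.1 n.1; rewrite (distrC m.1 z); lra.
- rewrite rayE // => dz mz; have [Km lt_m] := mids_near q m z qE mq mz.
  by have := e2P (d, q) e2 e20 (lexx _) dE qE dq z m.1 dz Km; lra.
rewrite !rayE // => dz d'z.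
have bb : base d = base d'.
  apply/eqP; apply: contraLR isT => bb; have := pos_far _ _ bb.
  have := ler_distD z (pos (base d)) (pos (base d')).
  have := ray_le d z dE dz; have := ray_le d' z d'E d'z.
  by rewrite (distrC (pos (base d)) z); lra.
(* Two radii of one ball that share a point other than the centre have the same tip, which would lie
   in two disjoint sets [K]. *)
split=> //; have [t t01 [zE zs]] := ray_near d z dE dz.
have [t' _ [zE' zs']] := ray_near d' z d'E d'z.
move: zE' zs'; rewrite -bb zs => zE' /(mulIf (lt0r_neq0 s0)) tt'.
have [t0|t0] := eqVneq t 0; first by move/eqP: zE; rewrite t0 scale0r subr_eq0 => /eqP.
move: zE'; rewrite zE -tt' => /(scalerI t0)/addIr tipE'; exfalso.
apply: (K_disjoint d.1 d'.1 (tip0 d)) => //; first exact: K_tip.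
by rewrite tipE'; apply: K_tip.
Qed.

End Polygonalization.

(** * Planar graphs of girth at least seven *)

Section PlanarDensity.
Local Open Scope nat_scope.
Variables (R : realType) (V : finType) (e : rel V).

Lemma planar_girth_edge_bound (g : nat) : irreflexive e -> planar R e ->
  (g%:R%:E <= girth R e)%E ->
  forall e' : rel V, symmetric e' -> subrel e' e ->
  g * \sum_v deg e' v <= 2 * (\sum_v deg e' v + g * #|[set v | 0 < deg e' v]%SET|).
Proof.
move=> e_irr e_planar e_girth e' e'_sym sub_e.
pose E := [set p : V * V | e' p.1 p.2 & enum_rank p.1 < enum_rank p.2]%SET.
have EP p : (p \in E) = e' p.1 p.2 && (enum_rank p.1 < enum_rank p.2) by rewrite inE.
have loopless p : p \in E -> p.1 != p.2.
  by rewrite EP => /andP[_]; apply: contraTneq => ->; rewrite ltnn.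
have oriented u v : (u, v) \in E -> (v, u) \notin E.
  by rewrite !EP /= => /andP[_ uv]; rewrite negb_and -leqNgt (ltnW uv) orbT.
have sum_deg : \sum_v deg e' v = 2 * #|E|.
  have -> : \sum_v deg e' v = \sum_v \sum_u e' v u.
    apply: eq_bigr => v _; rewrite /deg -sum1_card big_mkcond /=.
    by apply: eq_bigr => u _; rewrite inE; case: (e' v u).
  have cardE : #|E| = \sum_v \sum_u ((v, u) \in E).
    rewrite pair_bigA -sum1_card big_mkcond; apply: eq_bigr => -[v u] _ /=.
    by case: (_ \in E).
  rewrite mul2n -addnn {2}cardE [X in _ = _ + X]exchange_big cardE -big_split.
  apply: eq_bigr => v _; rewrite -big_split; apply: eq_bigr => u _ /=.
  rewrite !EP /= (e'_sym u v); case: (boolP (e' v u)) => //= /sub_e euv.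
  case: ltngtP => //= /ord_inj/enum_rank_inj vu.
  by rewrite vu e_irr in euv.
have EW p : p \in E -> p.1 \in [set v | 0 < deg e' v]%SET /\
    p.2 \in [set v | 0 < deg e' v]%SET.
  rewrite EP !inE => /andP[ep _]; split; apply/card_gt0P.
    by exists p.2; rewrite inE.
  by exists p.1; rewrite inE e'_sym.
(* A cycle inside [C] is a cycle of [e], so its length, and hence [#|C|], is at least [g]. *)
have girthP C : C \in cyclic_sets E -> C != finset.set0 -> g <= #|C|.
  rewrite inE => /andP[/fintype.subsetP CE /eqP bC] C0.
  have [||c [c3 uc cc] le_c] := @cyclic_set_card V C _ _ bC C0.
  - by move=> p /CE/loopless.
  - by move=> u v /CE/oriented; apply: contra => /CE.
  apply: leq_trans le_c; rewrite -(ler_nat R) -lee_fin.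
  apply: le_trans e_girth _; apply: ereal_inf_lbound; exists c => //; split=> //.
  have sub_c : subrel (fun u v => ((u, v) \in C) || ((v, u) \in C)) e.
    move=> u v /orP[]/CE; rewrite EP /= => /andP[+ _]; last rewrite e'_sym.
      exact: sub_e.
    exact: sub_e.
  by case: (c) cc => //= x s; apply: sub_path.
have E_sub p : p \in E -> e p.1 p.2 by rewrite EP => /andP[/sub_e].
have [pos [start [mid D]]] := planar_polygonal_drawing E_sub oriented loopless e_planar.
by rewrite sum_deg mulnCA leq_mul2l (polygonal_drawing_edge_bound loopless EW girthP D).
Qed.
End PlanarDensity.

Theorem theorem2 (R : realType) (V : finType) (e : rel V)
    (e_sym : symmetric e) (e_irr : irreflexive e)
    (e_planar : planar R e) (e_girth : (7%:R%:E <= girth R e)%E) :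
  (game_coloring_number e <= 5)%N.
Proof.
have [|f fP] := @service V e e_sym.
  move=> e' e'_sym sub_e.
  (* For [g = 7] the bound 7 s <= 2 s + 14 n is the sparsity 5 s <= 14 n. *)
  have := planar_girth_edge_bound e_irr e_planar e_girth e'_sym sub_e; lia.
rewrite /game_coloring_number; case: ex_minnP => n _; apply.
exact/asboolP/(activation_guarantees e_irr fP).
Qed.
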